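(* Let $\mu\in\mathbb C$ with $|\mu|>1$ and $\mu\notin\mathbb R$, and let $f_0(z)=\mu z$ and $f_1(z)=\dfrac{z}{\mu+z}$, viewed as Möbius transformations of the Riemann sphere $\widehat{\mathbb C}$. Consider the iterated function system $G=\langle f_0,f_1\rangle$ with probabilities $p_0=p_1=1/2$. Then: The $G$-orbit of any $z_0\in\widehat{\mathbb C}\setminus\{0\}$ is dense in $\widehat{\mathbb C}$. The delta measure $\delta_0$ is the only stationary probability measure. For any $\varepsilon>0$ and for Lebesgue almost every $z\in\widehat{\mathbb C}$, the following hold for $\nu_{p_0,p_1}$-almost all $\omega\in\Sigma$: (1) $f^n_\omega(z)\notin B(0,\varepsilon)$ for infinitely many $n$; (2) $\lim_{N\to\infty}\frac1N\left|\{0\le n<N : f^n_\omega(z)\in B(0,\varepsilon)\}\right|=1$.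
   Context: $B(0,\varepsilon)=\{z\in\mathbb C:|z|<\varepsilon\}$. $G=\langle f_0,f_1\rangle$ also denotes the semigroup of compositions of $f_0$ and $f_1$, and the $G$-orbit of $z_0$ is $\{g(z_0):g\in G\}$. In the iterated function system, at each step $f_0$ or $f_1$ is chosen at random, i.i.d., with probabilities $p_0$, $p_1$. A Borel measure $m$ on $\widehat{\mathbb C}$ is stationary if $m=p_0\,f_0m+p_1\,f_1m$, where $f_im(A)=m(f_i^{-1}(A))$ is the push-forward. $\Sigma=\{0,1\}^{\mathbb N}$ (indices starting at $0$) carries the product topology and Borel $\sigma$-algebra, and $\nu_{p_0,p_1}$ is the Bernoulli measure on $\Sigma$ with probabilities $p_0,p_1$ of the symbols $0,1$. For $\omega=(\omega_i)_{i\ge0}\in\Sigma$, $f^n_\omega(z)=f_{\omega_{n-1}}\circ\cdots\circ f_{\omega_0}(z)$. *)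

(* Defs.v *)
From HB Require Import structures.
From mathcomp Require Import all_boot all_order all_algebra lra.
From mathcomp Require Import all_classical all_reals all_analysis.
From mathcomp Require Import measurable_realfun.
From mathcomp Require Export complex.

Set Implicit Arguments.
Unset Strict Implicit.
Unset Printing Implicit Defensive.

Import Order.TTheory GRing.Theory Num.Theory numFieldNormedType.Exports.

Local Open Scope classical_set_scope.
Local Open Scope complex_scope.
Local Open Scope ring_scope.

(* The topology of the modulus on C; only the synonym R[i]^o has it in the
   library. *)
HB.instance Definition _ (R : rcfType) :=
  PseudoPointedMetric.copy R[i] R[i]^o.
HB.instance Definition _ (R : rcfType) := NormedModule.copy R[i] R[i]^o.

(* Some z is the finite point z, None is the point at infinity. *)
Definition sphere (R : realType) := one_point_compactification R[i].

HB.instance Definition _ (R : realType) := Pointed.on (sphere R).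
HB.instance Definition _ (R : realType) := Topological.on (sphere R).
HB.instance Definition _ (R : realType) :=
  Measurable.copy (sphere R) (g_sigma_algebraType (@open (sphere R))).

Definition mobius (R : realType) (a b c d : R[i]) (z : sphere R) : sphere R :=
  match z with
  | Some z => if c * z + d == 0 then None else Some ((a * z + b) / (c * z + d))
  | None => if c == 0 then None else Some (a / c)
  end.

Definition ifs (R : realType) (mu : R[i]) (b : bool) : sphere R -> sphere R :=
  if b then mobius 1 0 1 mu else mobius mu 0 0 1.

(* The identity is not included as an empty composition. *)
Inductive semigroup (I X : Type) (f : I -> X -> X) : (X -> X) -> Prop :=
| semigroup_gen i : semigroup f (f i)
| semigroup_comp g h :
    semigroup f g -> semigroup f h -> semigroup f (g \o h).

Definition semigroup_orbit (I X : Type) (f : I -> X -> X) (x : X) : set X :=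
  [set g x | g in semigroup f].

Definition is_stationary d (X : measurableType d) (R : realType) (p0 p1 : R)
    (f : bool -> X -> X) (m : set X -> \bar R) : Prop :=
  forall A, measurable A ->
    m A = (p0%:E * pushforward m (f false) A
           + p1%:E * pushforward m (f true) A)%E.

(* The symbols 0 and 1 are false and true. *)
Definition Sigma : Type := cantor_space.

HB.instance Definition _ := Pointed.on Sigma.
HB.instance Definition _ := Topological.on Sigma.
HB.instance Definition _ :=
  Measurable.copy Sigma (g_sigma_algebraType (@open Sigma)).

Definition cylinder (s : seq bool) : set Sigma :=
  [set w : Sigma | forall i, (i < size s)%N -> w i = nth false s i].

(* This determines nu, since cylinders form a pi-system that generates the
   Borel sigma-algebra; see bernoulli_exists below for existence. *)
Definition is_bernoulli (R : realType) (p0 p1 : R) (nu : set Sigma -> \bar R)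
    : Prop :=
  forall s, nu (cylinder s) = (\prod_(b <- s) (if b then p1 else p0))%:E.

Fixpoint random_iter (X : Type) (f : bool -> X -> X) (w : Sigma) (n : nat)
    (x : X) : X :=
  if n is n'.+1 then f (w n') (random_iter f w n' x) else x.

Definition sphere_ball0 (R : realType) (eps : R) : set (sphere R) :=
  [set Some z | z in [set z : R[i] | `|z| < eps%:C]].

Definition sphere_point (R : realType) (p : R * R) : sphere R :=
  Some (p.1 +i* p.2).

(* Planar Lebesgue measure, giving mass 0 to infinity: it has the same null
   sets as the spherical area. *)
Definition sphere_lebesgue (R : realType) : set (sphere R) -> \bar R :=
  pushforward (@lebesgue_measure R \x @lebesgue_measure R)%E (@sphere_point R).

Lemma open_prod_measurable (R : realType) (U : set (R * R)) :
  open U -> measurable U.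
Proof.
move=> oU.
pose box (q : rat * rat * (rat * rat)) : set (R * R) :=
  `]ratr q.1.1, ratr q.1.2[%classic `*` `]ratr q.2.1, ratr q.2.2[%classic.
have -> : U = \bigcup_(q : rat * rat * (rat * rat))
    (if `[< box q `<=` U >] then box q else set0).
  apply/seteqP; split=> [x Ux|x [q _]]; last by case: asboolP => // h /h.
  have : nbhs x U by exact: open_nbhs_nbhs.
  case=> -[A B] /= [/nbhs_ballP[a /= a0 aA] /nbhs_ballP[b /= b0 bB]] AB.
  have [q1] := @rat_in_itvoo R (x.1 - a) x.1 ltac:(by rewrite ltrBlDr ltrDl).
  have [q2] := @rat_in_itvoo R x.1 (x.1 + a) ltac:(by rewrite ltrDl).
  have [q3] := @rat_in_itvoo R (x.2 - b) x.2 ltac:(by rewrite ltrBlDr ltrDl).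
  have [q4] := @rat_in_itvoo R x.2 (x.2 + b) ltac:(by rewrite ltrDl).
  rewrite !in_itv/= => /andP[h7 h8] /andP[h5 h6] /andP[h3 h4] /andP[h1 h2].
  exists ((q1, q2), (q3, q4)) => //; rewrite asboolT.
    by rewrite /box/= /setX/= !in_itv/= h2 h3 h6 h7.
  move=> [y1 y2]; rewrite /box/= /setX/= !in_itv/= => -[/andP[k1 k2] /andP[k3 k4]].
  apply: AB; split => /=.
    apply: aA; rewrite /ball/= distrC ltr_distl.
    by rewrite (lt_trans h1 k1) (lt_trans k2 h4).
  apply: bB; rewrite /ball/= distrC ltr_distl.
  by rewrite (lt_trans h5 k3) (lt_trans k4 h8).
apply: countable_bigcupT_measurable => // q.
case: ifP => // _; apply: measurableX => //; exact: measurable_itv.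
Qed.

Lemma continuous_sphere_point (R : realType) :
  continuous (@sphere_point R : R * R -> sphere R).
Proof.
move=> [x y] U /= Uxy.
have {Uxy} : nbhs (x +i* y : R[i]) (Some @^-1` U) by exact: Uxy.
move=> /(nbhs_ballP (x +i* y : R[i]))[e /=]; rewrite ltcE /= => /andP[/eqP e0 e1] eU.
pose d := complex.Re e / 2; have d0 : 0 < d by rewrite divr_gt0.
exists (ball x d, ball y d); first by split; exact: nbhsx_ballx.
move=> [x' y'] [/= xx' yy']; apply: eU; rewrite /ball/=.
have -> : x +i* y - (x' +i* y') = (x - x')%:C + 'i * (y - y')%:C.
  by simpc.
apply: (le_lt_trans (ler_normD _ _)).
rewrite normrM !normc_def /= !(expr0n, addr0, add0r, expr1n, sqrtr1) mul1r.
rewrite !sqrtr_sqr -rmorphD/=.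
rewrite ltcE/= e0 eqxx/=.
by rewrite (splitr (complex.Re e)) ltrD.
Qed.

Lemma measurable_sphere_point (R : realType) :
  measurable_fun setT (@sphere_point R).
Proof.
apply: (@measurability _ _ _ _ _ _ (@open (sphere R))) => // _ [U oU <-].
rewrite setTI; apply: open_prod_measurable.
by move/continuousP: (@continuous_sphere_point R); exact.
Qed.

HB.instance Definition _ (R : realType) := Measure.copy (@sphere_lebesgue R)
  (measure_function_pushforward__canonical__measure_function_Measure
     (lebesgue_measure \x lebesgue_measure)%E (@measurable_sphere_point R)).

Lemma open_cylinder (U : set Sigma) (w : Sigma) :
  open U -> U w -> exists n, cylinder (mkseq w n) `<=` U.
Proof.
move=> oU Uw.
pose F := filter_from setT (fun n => cylinder (mkseq w n)).
have FF : Filter F.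
  apply: filter_fromT_filter; first by exists 0%N.
  move=> i j; exists (maxn i j) => v; rewrite /cylinder/= => h.
  have {}h k : (k < maxn i j)%N -> v k = w k.
    by move=> ki; rewrite h ?size_mkseq// nth_mkseq.
  by split => k /[!size_mkseq] ki; rewrite nth_mkseq// h// leq_max ki ?orbT.
have /(_ U) : F --> w.
  apply/(@cvg_sup _ _ _ F w FF) => i A; rewrite nbhsE/= => -[_ [[B oB <-] Bw] BA].
  exists i.+1 => // v h; apply: BA; rewrite /preimage/=.
  suff -> : v i = w i by [].
  by rewrite h ?size_mkseq// nth_mkseq.
by case=> [|n _]; [exact: open_nbhs_nbhs | exists n].
Qed.

Section bernoulli_exists.
Context (R : realType) (p : R) (p0 : 0 < p) (p1 : p < 1).

(* The itinerary under this full-branch expanding map of [0, 1[ carries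
   Lebesgue measure to the Bernoulli measure. *)
Let shift (x : R) : R := if x < p then x / p else (x - p) / (1 - p).

Let code (x : R) : Sigma := fun n => p <= iter n shift x.

Let measurable_shift : measurable_fun setT shift.
Proof.
apply: measurable_fun_ifT => //; first exact: measurable_fun_ltr.
  exact: mulrr_measurable.
by apply: measurable_funM => //; exact: measurable_funB.
Qed.

Let measurable_iter n : measurable_fun setT (iter n shift).
Proof.
elim: n => [|n IH]; first exact: measurable_id.
exact: measurableT_comp measurable_shift IH.
Qed.

Let measurable_cyl s : measurable (code @^-1` cylinder s).
Proof.
have -> : code @^-1` cylinder s = \bigcap_(i in `I_(size s))
    ((fun x => p <= iter i shift x) @^-1` [set nth false s i]).
  by apply/seteqP; split.
apply: bigcap_measurableType => // i _; rewrite -[X in measurable X]setTI.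
by apply: measurable_fun_ler.
Qed.

Let measurable_code : measurable_fun setT code.
Proof.
apply: (@measurability _ _ _ _ _ _ (@open Sigma)) => // _ [U oU <-].
rewrite setTI.
have -> : code @^-1` U = \bigcup_(s : seq bool)
    (if `[< cylinder s `<=` U >] then code @^-1` cylinder s else set0).
  apply/seteqP; split=> [x Ux|x [s _]]; last by case: asboolP => // h /h.
  have [n nU] := open_cylinder oU Ux; exists (mkseq (code x) n) => //.
  by rewrite asboolT// => i; rewrite size_mkseq => ni; rewrite nth_mkseq.
by apply: countable_bigcupT_measurable => // s; case: ifP.
Qed.

Let code_cyl s : exists2 a : R,
  code @^-1` cylinder s `&` `[0, 1[ =
    `[a, a + \prod_(b <- s) (if b then 1 - p else p)[%classic &
  0 <= a /\ a + \prod_(b <- s) (if b then 1 - p else p) <= 1.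
Proof.
have q0 : 0 < 1 - p by rewrite subr_gt0.
elim: s => [|b s [a IH [a0 a1]]].
  exists 0; rewrite ?big_nil ?add0r//.
  by apply/seteqP; split => [x []|x ]//=.
rewrite big_cons; set P := \prod_(_ <- _) _ in IH a1 *.
have cylE x : (code @^-1` cylinder (b :: s)) x <->
    (p <= x) = b /\ (code @^-1` cylinder s) (shift x).
  split=> [h|[h1 h2] [|i]//= si].
    split; first exact: (h 0%N).
    by move=> i si; have := h i.+1 si; rewrite /code/= -iterSr.
  by have := h2 i si; rewrite /code/= -iterSr.
have IHx y : 0 <= y < 1 -> (code @^-1` cylinder s) y <-> a <= y < a + P.
  move=> y01; have := congr1 (@^~ y) IH; rewrite /= !in_itv/= => <-.
  by split=> [|[]].
exists (if b then p + a * (1 - p) else a * p).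
  apply/seteqP; split=> x; rewrite /= !in_itv/=.
    move=> [/cylE[xb]]; rewrite /shift ltNge xb => + /andP[x0 x1].
    case: b {cylE} xb => xb /=.
      move=> /IHx; rewrite ler_pdivlMr// ltr_pdivrMr// ler_pdivlMr// ltr_pdivrMr//.
      rewrite mul0r subr_ge0 mul1r xb ltrD2r x1 => /(_ isT)/andP[? ?].
      by apply/andP; split; lra.
    have {}xb : x < p by rewrite ltNge xb.
    move=> /IHx; rewrite ler_pdivlMr// ltr_pdivrMr// ler_pdivlMr// ltr_pdivrMr//.
    rewrite mul0r mul1r xb x0 => /(_ isT)/andP[? ?].
    by apply/andP; split; lra.
  case: b cylE => cylE /andP[h1 h2].
    have px : p <= x by have := mulr_ge0 a0 (ltW q0); lra.
    have x1 : x < 1 by have := ler_wpM2r (ltW q0) a1; lra.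
    split; last by rewrite (le_trans (ltW p0) px) x1.
    apply/cylE; rewrite px; split => //; rewrite /shift ltNge px/=; apply/IHx.
      by rewrite ler_pdivlMr// ltr_pdivrMr//; apply/andP; split; lra.
    by rewrite ler_pdivlMr// ltr_pdivrMr//; apply/andP; split; lra.
  have px : x < p by have := ler_wpM2r (ltW p0) a1; lra.
  have x0 : 0 <= x by have := mulr_ge0 a0 (ltW p0); lra.
  split; last by rewrite x0 (lt_trans px p1).
  apply/cylE; rewrite leNgt px; split => //; rewrite /shift px/=; apply/IHx.
    by rewrite ler_pdivlMr// ltr_pdivrMr//; apply/andP; split; lra.
  by rewrite ler_pdivlMr// ltr_pdivrMr//; apply/andP; split; lra.
case: b {cylE}; split.
- by rewrite addr_ge0 ?mulr_ge0// ltW.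
- by have := ler_wpM2r (ltW q0) a1; lra.
- by rewrite mulr_ge0// ltW.
- by have := ler_wpM2r (ltW p0) a1; lra.
Qed.

Lemma bernoulli_exists :
  exists nu : probability Sigma R, is_bernoulli p (1 - p) nu.
Proof.
have mI : measurable (`[0, 1[%classic : set R) by exact: measurable_itv.
pose m := measure_function_pushforward__canonical__measure_function_Measure
  (mrestr (@lebesgue_measure R) mI) measurable_code.
have mcyl s : m (cylinder s) = (\prod_(b <- s) (if b then 1 - p else p))%:E.
  rewrite /m/= /pushforward/= /mrestr/=.
  have [a -> [a0 a1]] := code_cyl s.
  rewrite lebesgue_measure_itv/= lte_fin ltrDl.
  have P0 : 0 < \prod_(b <- s) (if b then 1 - p else p).
    by apply: prodr_gt0 => -[] _; rewrite ?subr_gt0.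
  by rewrite P0 -EFinB addrAC subrr add0r.
have mT : m setT = 1%E.
  have <- : cylinder [::] = setT by apply/seteqP; split.
  by rewrite mcyl big_nil.
exists (mnormalize m (dirac (point : Sigma))) => s.
rewrite [LHS]/= /mnormalize mT; case: ifPn => [|_].
  by case/orP => /eqP // [] /eqP; rewrite oner_eq0.
by rewrite /= invr1 mule1 mcyl.
Qed.

End bernoulli_exists.

(* Main.v *)
(* In the coordinate w = 1/z the maps become the affine maps w / mu and mu w + 1
   of C, and the fixed point 0 becomes infinity.

   The words 10 and 01 are translations by 1 and 1/mu. Interleaving the first
   with contractions by powers of 1/mu yields all numbers sum_j n_j mu^-j with
   n_j in N, and these are dense in C because mu is not real.

   Let Q(rho) be the limit, as n grows, of the maximal probability that n random
   steps lead into a given disc of radius rho. Peeling off the last step gives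
   2 Q(rho) <= Q(|mu| rho) + Q(rho / |mu|), so k |-> Q(|mu|^k rho) is convex and
   bounded, hence constant. As 01 and 10 are distinct translations, peeling off
   the last two steps gives 4 Q(rho) <= 3 Q(rho) for small rho, hence Q = 0.
   Thus a stationary probability gives mass 0 to every disc of the w-plane, and an
   exponential supermartingale built from the expected number of visits bounds
   the frequency of visits to a disc, by Borel-Cantelli.

   Conversely, ln (|w| - 1 / (|mu| - 1)^2) is superharmonic far away; corrected
   by a multiple of - |w|^-a it is superharmonic outside any given disc around
   0, so that the random walk returns to that disc infinitely often. *)

Require Import Defs.
From HB Require Import structures.
From mathcomp Require Import all_boot all_order all_algebra ring lra.
From mathcomp Require Import all_classical all_reals all_analysis.
From mathcomp Require Import measurable_realfun.

Set Implicit Arguments.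
Unset Strict Implicit.
Unset Printing Implicit Defensive.

Import Order.TTheory GRing.Theory Num.Theory numFieldNormedType.Exports.

Local Open Scope classical_set_scope.
Local Open Scope complex_scope.
Local Open Scope ring_scope.

(** * Modulus and averaging operator *)

Definition modulus (R : realType) (z : R[i]) : R := complex.Re `|z|.

Section modulus.
Context {R : realType}.
Implicit Types z w : R[i].

Lemma normE z : `|z| = (modulus z)%:C.
Proof. by rewrite /modulus normc_def. Qed.

Lemma modulus_ge0 z : 0 <= modulus z.
Proof. by rewrite /modulus normc_def /= sqrtr_ge0. Qed.

Lemma modulusM z w : modulus (z * w) = modulus z * modulus w.
Proof.
by have := normrM z w; rewrite !normE -rmorphM => /(congr1 (@complex.Re R)).
Qed.

Lemma modulus0 : modulus (0 : R[i]) = 0.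
Proof. by rewrite /modulus normr0. Qed.

Lemma modulus1 : modulus (1 : R[i]) = 1.
Proof. by rewrite /modulus normr1. Qed.

Lemma modulusN z : modulus (- z) = modulus z.
Proof. by rewrite /modulus normrN. Qed.

Lemma modulus_eq0 z : (modulus z == 0) = (z == 0).
Proof.
rewrite -[RHS]normr_eq0 normE; apply/eqP/eqP => [->//|].
by move/(congr1 (@complex.Re R)).
Qed.

Lemma modulusV z : modulus z^-1 = (modulus z)^-1.
Proof.
have [->|z0] := eqVneq z 0; first by rewrite invr0 modulus0 invr0.
have mz : modulus z != 0 by rewrite modulus_eq0.
by apply: (mulfI mz); rewrite -modulusM !divff// modulus1.
Qed.

Lemma modulusX z n : modulus (z ^+ n) = modulus z ^+ n.
Proof. by elim: n => [|n IH]; rewrite ?expr0 ?modulus1// !exprS modulusM IH. Qed.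

Lemma modulusD z w : modulus (z + w) <= modulus z + modulus w.
Proof. by have := ler_normD z w; rewrite !normE -rmorphD lecE/= => /andP[]. Qed.

Lemma modulusC (x : R) : 0 <= x -> modulus x%:C = x.
Proof. by move=> x0; rewrite /modulus ger0_norm// lecE/= eqxx. Qed.

End modulus.

Definition branch (R : realType) (mu : R[i]) (b : bool) (w : R[i]) : R[i] :=
  if b then mu * w + 1 else mu^-1 * w.

(** The Markov operator of the walk: its [n]-th iterate at [w] is the mean of [phi] after [n] random
    steps from [w]. *)
Definition transfer (R : realType) (mu : R[i]) (phi : R[i] -> R) (w : R[i]) : R :=
  (phi (branch mu false w) + phi (branch mu true w)) / 2.

Definition ball_ind (R : realType) (c : R[i]) (rho : R) (w : R[i]) : R :=
  (modulus (w - c) <= rho)%R%:R.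

Section transfer.
Context {R : realType} (mu : R[i]).
Implicit Types (phi psi : R[i] -> R) (w c : R[i]) (n : nat).

Local Notation P := (transfer mu).

Lemma iter_transferS n phi w : iter n.+1 P phi w =
  (iter n P phi (branch mu false w) + iter n P phi (branch mu true w)) / 2.
Proof. by []. Qed.

Lemma le_iter_transfer n phi psi : (forall w, phi w <= psi w) ->
  forall w, iter n P phi w <= iter n P psi w.
Proof.
elim: n => // n IH h w; rewrite !iter_transferS.
by rewrite ler_pM2r ?invr_gt0// lerD// IH.
Qed.

Lemma iter_transfer_cst n (x : R) w : iter n P (fun=> x) w = x.
Proof. by elim: n w => // n IH w; rewrite iter_transferS !IH; field. Qed.

Lemma iter_transferD n phi psi w :
  iter n P (fun w => phi w + psi w) w = iter n P phi w + iter n P psi w.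
Proof. by elim: n w => // n IH w; rewrite !iter_transferS !IH; field. Qed.

Lemma iter_transferZ n (a : R) phi w :
  iter n P (fun w => a * phi w) w = a * iter n P phi w.
Proof. by elim: n w => // n IH w; rewrite !iter_transferS !IH; field. Qed.

(** The first [m - n] steps only average values already bounded by [x]; this lets bounds for
    different step counts be combined. *)
Lemma iter_transfer_le_cst n m phi (x : R) : (n <= m)%N ->
  (forall w, iter n P phi w <= x) -> forall w, iter m P phi w <= x.
Proof.
move=> nm h w; rewrite -(subnK nm) iterD.
by rewrite -[leRHS](iter_transfer_cst (m - n) x w); exact: le_iter_transfer.
Qed.

Lemma iter_transfer_ge0 n phi w : (forall w, 0 <= phi w) -> 0 <= iter n P phi w.
Proof.
by move=> h; rewrite -[leLHS](iter_transfer_cst n 0 w); exact: le_iter_transfer.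
Qed.

Lemma ball_ind_ge0 c rho w : 0 <= ball_ind c rho w.
Proof. exact: ler0n. Qed.

Lemma ball_ind_le1 c rho w : ball_ind c rho w <= 1.
Proof. by rewrite /ball_ind lern1 leq_b1. Qed.

End transfer.

(** * Decay of the concentration function *)

Lemma expr_dominates (R : archiRealFieldType) (l x y : R) : 1 < l -> 0 < x -> 
  exists k, y <= l ^+ k * x.
Proof.
move=> l1 x0.
have bern k : 1 + k%:R * (l - 1) <= l ^+ k.
  elim: k => [|k IH]; first by rewrite mul0r addr0 expr0.
  have : 1 <= l ^+ k by rewrite exprn_ege1// ltW.
  by rewrite exprS -addn1 natrD; nra.
have lx : 0 < (l - 1) * x by rewrite mulr_gt0// subr_gt0.
exists (Num.bound (`|y| / ((l - 1) * x))).
set k := Num.bound _.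
have : `|y| / ((l - 1) * x) < k%:R by apply: archi_boundP; rewrite divr_ge0// ltW.
rewrite ltr_pdivrMr// mulrA => h.
apply: le_trans (ler_norm y) _; apply: le_trans (ltW h) _.
by rewrite ler_pM2r//; have := bern k; lra.
Qed.

Section concentration.
Context {R : realType} (mu : R[i]) (mu_gt1 : 1 < modulus mu) (mu1 : mu != 1).
Implicit Types (w c : R[i]) (rho : R).

Local Notation P := (transfer mu).
Local Notation l := (modulus mu).
Let l0 : 0 < l. Proof. exact: lt_trans mu_gt1. Qed.
Let mu0 : mu != 0. Proof. by rewrite -modulus_eq0 gt_eqF. Qed.

Lemma modulus_branch0 c rho w :
  (modulus (branch mu false w - c) <= rho) = (modulus (w - mu * c) <= l * rho).
Proof.
rewrite /branch; have -> : w - mu * c = mu * (mu^-1 * w - c) by field.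
by rewrite modulusM ler_pM2l.
Qed.

Lemma modulus_branch1 c rho w :
  (modulus (branch mu true w - c) <= rho)
    = (modulus (w - (c - 1) / mu) <= rho / l).
Proof.
rewrite /branch; have -> : mu * w + 1 - c = mu * (w - (c - 1) / mu) by field.
by rewrite modulusM ler_pdivlMr// mulrC.
Qed.

Lemma transfer_ball_ind c rho : P (ball_ind c rho) =
  fun w => 2^-1 * (ball_ind (mu * c) (l * rho) w
                   + ball_ind ((c - 1) / mu) (rho / l) w).
Proof.
apply/funext => w.
by rewrite /transfer /ball_ind modulus_branch0 modulus_branch1 mulrC.
Qed.

(* The maximal probability that n steps lead into a disc of radius rho, over
   all starting points and all centers, decreases with n; conc is its limit. *)
Let conc_ub rho : set R :=
  [set x | exists n, forall c w, iter n P (ball_ind c rho) w <= x].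

Let conc rho : R := inf (conc_ub rho).

Let conc_ub1 rho : conc_ub rho 1.
Proof. by exists 0%N => c w; exact: ball_ind_le1. Qed.

Let conc_ub_ge0 rho : lbound (conc_ub rho) 0.
Proof.
move=> x [n /(_ 0 0)]; apply: le_trans.
by apply: iter_transfer_ge0 => w; exact: ball_ind_ge0.
Qed.

Let has_inf_conc rho : has_inf (conc_ub rho).
Proof. by split; [exists 1; exact: conc_ub1|exists 0; exact: conc_ub_ge0]. Qed.

Let conc_le rho x : conc_ub rho x -> conc rho <= x.
Proof. by move=> h; apply: ge_inf => //; exists 0; exact: conc_ub_ge0. Qed.

Let conc_ge0 rho : 0 <= conc rho.
Proof. by apply: lb_le_inf; [exists 1; exact: conc_ub1|exact: conc_ub_ge0]. Qed.

Let conc_adh rho (e : R) : 0 < e -> exists2 x, conc_ub rho x & x < conc rho + e.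
Proof. by move=> e0; exact: inf_adherent. Qed.

Let conc_mono rho rho' : rho <= rho' -> conc rho <= conc rho'.
Proof.
move=> h; apply: lb_le_inf => [|x [n H]]; first by exists 1; exact: conc_ub1.
apply: conc_le; exists n => c w; apply: le_trans (H c w).
apply: le_iter_transfer => v; rewrite /ball_ind ler_nat.
by case: (leP _ rho) => // /le_trans -> //.
Qed.

Let conc_convex rho : 2 * conc rho <= conc (l * rho) + conc (rho / l).
Proof.
apply/ler_addgt0Pr => e e0; have e20 : 0 < e / 2 by rewrite divr_gt0.
have [x [n hx] xlt] := conc_adh (l * rho) e20.
have [y [m hy] ylt] := conc_adh (rho / l) e20.
have : conc_ub rho (2^-1 * (x + y)).
  exists (maxn n m).+1 => c w; rewrite iterSr transfer_ball_ind iter_transferZ.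
  rewrite ler_pM2l ?invr_gt0// iter_transferD.
  by apply: lerD; [apply: iter_transfer_le_cst (hx _) _|
    apply: iter_transfer_le_cst (hy _) _]; rewrite ?leq_maxl ?leq_maxr.
by move=> /conc_le; lra.
Qed.

(* A bounded convex function on the integers is constant. *)
Let conc_scale rho : 0 <= rho -> conc (l * rho) = conc rho.
Proof.
move=> rho0; apply/eqP; rewrite eq_le; apply/andP; split; last first.
  by apply: conc_mono; rewrite ler_peMl// ltW.
rewrite leNgt; apply/negP => lt.
pose d := conc (l * rho) - conc rho.
have d0 : 0 < d by rewrite subr_gt0.
(* Convexity keeps the increments nondecreasing, so a positive first increment would push [conc]
   past 1. *)
have step k : d <= conc (l ^+ k.+1 * rho) - conc (l ^+ k * rho).
  elim: k => [|k IH]; first by rewrite expr1 expr0 mul1r.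
  have := conc_convex (l ^+ k.+1 * rho).
  have -> : l * (l ^+ k.+1 * rho) = l ^+ k.+2 * rho by rewrite mulrA -exprS.
  have -> : l ^+ k.+1 * rho / l = l ^+ k * rho.
    by rewrite exprS; field; rewrite gt_eqF.
  lra.
have lin k : k%:R * d <= conc (l ^+ k * rho).
  elim: k => [|k IH]; first by rewrite mul0r conc_ge0.
  by have := step k; rewrite -addn1 natrD mulrDl mul1r; lra.
have [k hk] : exists k : nat, 1 < k%:R * d.
  exists (Num.bound d^-1); rewrite -ltr_pdivrMr// mul1r.
  by apply: archi_boundP; rewrite invr_ge0 ltW.
have : conc (l ^+ k * rho) <= 1 by apply: conc_le; exact: conc_ub1.
by have := lin k; lra.
Qed.

Let conc_scaleX rho k : 0 <= rho -> conc (l ^+ k * rho) = conc rho.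
Proof.
move=> rho0; elim: k => [|k IH]; first by rewrite expr0 mul1r.
by rewrite exprS -mulrA conc_scale ?IH// mulr_ge0 ?exprn_ge0// ltW.
Qed.

Let sep : R := modulus (1 - mu^-1).

Let sep0 : 0 < sep.
Proof.
rewrite lt_def modulus_ge0 andbT modulus_eq0 subr_eq0; apply/negP => /eqP h.
by move: mu1; rewrite -(invrK mu) -h invr1 eqxx.
Qed.

(* The words 01 and 10 are distinct translations, so two small discs they lead
   to are disjoint. *)
Let ball_ind_disjoint c rho w : 0 <= rho -> 2 * rho < sep ->
  ball_ind (c - mu^-1) rho w + ball_ind (c - 1) rho w
    <= ball_ind (c - 1) (rho + sep) w.
Proof.
move=> rho0 small; rewrite /ball_ind.
have e1 : w - (c - 1) = (w - (c - mu^-1)) + (1 - mu^-1) by ring.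
have e2 : 1 - mu^-1 = (w - (c - 1)) + - (w - (c - mu^-1)) by ring.
have h1 : modulus (w - (c - 1)) <= modulus (w - (c - mu^-1)) + sep.
  by rewrite [in leLHS]e1 modulusD.
have h2 : sep <= modulus (w - (c - 1)) + modulus (w - (c - mu^-1)).
  by rewrite /sep {1}e2 (le_trans (modulusD _ _))// modulusN.
case: (leP (modulus (w - (c - mu^-1))) rho) => k1;
  case: (leP (modulus (w - (c - 1))) rho) => k2;
  case: (leP (modulus (w - (c - 1))) (rho + sep)) => k3 //=;
  rewrite ?addr0 ?add0r ?lexx// ?ler01//; exfalso; have := sep0; lra.
Qed.

(** Of the four discs pulled back along two-letter words, those of 01 and 10 have radius [rho] and
    are disjoint, so one larger disc counts for both: three discs against the factor 1/4. *)
Let transfer2_ball_ind c rho w : 0 <= rho -> 2 * rho < sep ->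
  P (P (ball_ind c rho)) w <= 4^-1 *
    (ball_ind (mu ^+ 2 * c) (l ^+ 2 * rho) w +
     (ball_ind (c - 1) (rho + sep) w +
      ball_ind (((c - 1) / mu - 1) / mu) (rho / l / l) w)).
Proof.
move=> rho0 small; rewrite [P (ball_ind c rho)]transfer_ball_ind /transfer.
rewrite /ball_ind !modulus_branch0 !modulus_branch1.
have -> : mu * ((c - 1) / mu) = c - 1 by field.
have -> : (mu * c - 1) / mu = c - mu^-1 by field.
have -> : l * (rho / l) = rho by field; rewrite gt_eqF.
have -> : l * rho / l = rho by field; rewrite gt_eqF.
rewrite !mulrA -!expr2.
have := @ball_ind_disjoint c rho w rho0 small; rewrite /ball_ind; lra.
Qed.

Let conc_small rho : 0 <= rho -> 2 * rho < sep ->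
  4 * conc rho <= conc (l ^+ 2 * rho) + conc (rho + sep) + conc (rho / l / l).
Proof.
move=> rho0 small.
apply/ler_addgt0Pr => e e0; have e30 : 0 < e / 3 by rewrite divr_gt0.
have [x [n hx] xlt] := conc_adh (l ^+ 2 * rho) e30.
have [y [m hy] ylt] := conc_adh (rho + sep) e30.
have [z [k hz] zlt] := conc_adh (rho / l / l) e30.
have : conc_ub rho (4^-1 * (x + (y + z))).
  pose N := maxn n (maxn m k).
  exists N.+2 => c w; rewrite !iterSr.
  apply: le_trans (@le_iter_transfer _ _ _ _ _ _ w) _.
    by move=> v; exact: transfer2_ball_ind.
  rewrite iter_transferZ ler_pM2l ?invr_gt0// !iter_transferD.
  apply: lerD; last apply: lerD.
  - by apply: iter_transfer_le_cst (hx _) _; rewrite leq_maxl.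
  - by apply: iter_transfer_le_cst (hy _) _; rewrite /N maxnCA leq_maxl.
  - by apply: iter_transfer_le_cst (hz _) _; rewrite /N maxnA leq_maxr.
by move=> /conc_le; lra.
Qed.

Let conc_eq0 rho : 0 <= rho -> conc rho = 0.
Proof.
(* By monotonicity and invariance under scaling, each of the three terms in [conc_small] is at most
   [q = conc (sep / 4)], so [4 q <= 3 q]. *)
have base : conc (sep / 4) = 0.
  have r0 : 0 <= sep / 4 by rewrite divr_ge0// ltW.
  have [k hk] := @expr_dominates _ l (sep / 4) (sep / 4 + sep) mu_gt1
    ltac:(by rewrite divr_gt0).
  have := conc_small r0 ltac:(by have := sep0; lra).
  rewrite conc_scaleX//.
  have := conc_mono hk; rewrite conc_scaleX//.
  have : sep / 4 / l / l <= sep / 4.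
    by rewrite 2?ler_pdivrMr// -[leRHS]mulrA ler_peMr// mulr_ege1// ltW.
  by move=> /conc_mono; have := conc_ge0 (sep / 4); lra.
move=> rho0; apply/eqP; rewrite eq_le conc_ge0 andbT.
have [k hk] := @expr_dominates _ l (sep / 4) rho mu_gt1
  ltac:(by rewrite divr_gt0).
rewrite -base -(@conc_scaleX (sep / 4) k) ?conc_mono// divr_ge0// ltW//.
Qed.

Lemma concentration (eta rho : R) : 0 < eta -> 0 <= rho ->
  exists n, forall c w, iter n P (ball_ind c rho) w <= eta.
Proof.
move=> eta0 rho0; have [x [n hx] xlt] := conc_adh rho eta0.
exists n => c w; apply: le_trans (hx c w) _.
by move: xlt; rewrite conc_eq0// add0r => /ltW.
Qed.

End concentration.

(** * Frequency of visits to a disc *)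

(* The mean of the product of kappa over the first n points of the random walk
   from w. *)
Fixpoint feynman_kac (R : realType) (mu : R[i]) (kappa : R[i] -> R) (n : nat)
    (w : R[i]) : R :=
  if n is n'.+1 then kappa w * transfer mu (feynman_kac mu kappa n') w else 1.

Section feynman_kac.
Context {R : realType} (mu : R[i]).
Implicit Types (phi psi kappa : R[i] -> R) (w : R[i]) (n : nat).

Local Notation P := (transfer mu).

Lemma le_transfer phi psi : (forall w, phi w <= psi w) ->
  forall w, P phi w <= P psi w.
Proof. exact: (@le_iter_transfer _ mu 1). Qed.

Lemma transferZ (a : R) phi w : P (fun w => a * phi w) w = a * P phi w.
Proof. exact: (@iter_transferZ _ mu 1). Qed.

Lemma feynman_kac_ge0 kappa n w : (forall w, 0 <= kappa w) ->
  0 <= feynman_kac mu kappa n w.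
Proof.
move=> k0; elim: n w => //= n IH w; rewrite mulr_ge0//.
exact: (@iter_transfer_ge0 _ mu 1).
Qed.

(** A supersolution [psi >= 1] dominates the initial value 1, and each step costs a factor of at
    most [theta]. *)
Lemma feynman_kac_le kappa psi (theta : R) n w : 0 <= theta ->
  (forall w, 0 <= kappa w) -> (forall w, 1 <= psi w) ->
  (forall w, kappa w * P psi w <= theta * psi w) ->
  feynman_kac mu kappa n w <= theta ^+ n * psi w.
Proof.
move=> t0 k0 psi1 h; elim: n w => /= [|n IH] w; first by rewrite expr0 mul1r.
apply: (@le_trans _ _ (kappa w * (theta ^+ n * P psi w))).
  by rewrite ler_wpM2l// -transferZ; exact: le_transfer.
rewrite mulrCA exprSr -mulrA ler_wpM2l ?exprn_ge0//.
Qed.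

End feynman_kac.

(** Sets the reward [(1 + x) ^ d] for a visit against a relative loss of [d x] in the
    supersolution. *)
Lemma bernoulli_reverse (R : realDomainType) (x : R) d : 0 <= x ->
  (1 + x) ^+ d * (1 - d%:R * x) <= 1.
Proof.
move=> x0; elim: d => [|d]; first by rewrite expr0 mul0r subr0 mul1r.
apply: le_trans; rewrite exprSr -mulrA ler_wpM2l//.
  by rewrite exprn_ge0// addr_ge0.
rewrite -subr_ge0.
have -> : 1 - d%:R * x - (1 + x) * (1 - d.+1%:R * x) = d.+1%:R * x ^+ 2.
  by rewrite -addn1 natrD; ring.
by rewrite mulr_ge0// sqr_ge0.
Qed.

(* The weight of one step, whose product over N steps is at least 1 exactly
   when at least N / d of them start in the disc. *)
Definition visit_weight (R : realType) (K beta : R) (d : nat) (w : R[i]) : R :=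
  beta^-1 * beta ^+ (d * (modulus w <= K)%R).

Section frequency.
Context {R : realType} (mu : R[i]) (mu_gt1 : 1 < modulus mu) (mu1 : mu != 1).

Local Notation P := (transfer mu).

Lemma transfer_potential phi n w :
  P (fun w => \sum_(i < n) iter i P phi w) w + phi w
    = \sum_(i < n) iter i P phi w + iter n P phi w.
Proof.
rewrite [in RHS](_ : \sum_(i < n) _ + _ = \sum_(i < n.+1) iter i P phi w).
  rewrite big_ord_recl addrC; congr (_ + _).
  by rewrite /transfer -big_split mulr_suml.
by rewrite big_ord_recr.
Qed.

(* With [Phi := \sum_(i < n) P^i 1_B], one has [P Phi <= Phi - 1_B + eta], so
   that [1 + Phi / n] is a supersolution for the weights. *)
Lemma visits_exponential_bound (K : R) d : 0 <= K ->
  exists beta theta : R, [/\ 1 < beta, 0 < theta, theta < 1 &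
    forall n w, feynman_kac mu (visit_weight K beta d) n w <= theta ^+ n * 2].
Proof.
(* With [x = 2 a eta] below, this makes [d x = a / 2 - a eta]. As [1 <= X <= 2], the drop [a] on the
   disc then suffices for [P X <= (1 - d x) X]. *)
move=> K0; pose eta : R := (4 * d%:R + 2)^-1.
have D0 : 0 < 4 * d%:R + 2 :> R by have : 0 <= d%:R :> R by []; lra.
have eta0 : 0 < eta by rewrite invr_gt0.
have [n0 hn0] := concentration mu_gt1 mu1 eta0 K0.
(* The successor keeps [n] positive, so that [a = 1 / n] is a true inverse. *)
pose n := n0.+1.
have hn w : iter n P (ball_ind 0 K) w <= eta.
  by apply: iter_transfer_le_cst (hn0 0) _; rewrite leqnSn.
pose Phi w := \sum_(i < n) iter i P (ball_ind 0 K) w.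
have Phi0 w : 0 <= Phi w.
  by apply: sumr_ge0 => i _; apply: iter_transfer_ge0 => v; exact: ball_ind_ge0.
have Phin w : Phi w <= n%:R.
  rewrite -[n in leRHS]card_ord -sumr_const; apply: ler_sum => i _.
  by apply: (@iter_transfer_le_cst _ _ 0) => // v; exact: ball_ind_le1.
pose a : R := n%:R^-1.
have a0 : 0 < a by rewrite invr_gt0 ltr0n.
have an : a * n%:R = 1 by rewrite mulVf// pnatr_eq0.
pose X w := 1 + a * Phi w.
have X1 w : 1 <= X w by rewrite lerDl mulr_ge0// ltW.
have X2 w : X w <= 2.
  by have := Phin w; rewrite -(ler_pM2l a0) an /X; lra.
have PX w : P X w <= X w - a * ball_ind 0 K w + a * eta.
  have -> : P X w = 1 + a * P Phi w.
    by rewrite /X /transfer; field.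
  have := transfer_potential (ball_ind 0 K) n w; rewrite -/(Phi w) => e.
  have := hn w; rewrite -(ler_pM2l a0) /X.
  have : a * P Phi w + a * ball_ind 0 K w
      = a * Phi w + a * iter n P (ball_ind 0 K) w.
    by rewrite -!mulrDr e.
  lra.
pose x := 2 * (a * eta); have x0 : 0 < x by rewrite !mulr_gt0.
pose beta := 1 + x; have b1 : 1 < beta by rewrite ltrDl.
have b0 : 0 < beta by exact: lt_trans b1.
pose theta := (1 + a * eta) / beta.
have ae0 : 0 < a * eta by rewrite mulr_gt0.
exists beta, theta; split => //.
- by rewrite divr_gt0// addr_gt0.
- by rewrite ltr_pdivrMr// mul1r /beta /x; lra.
move=> N w; apply: (@le_trans _ _ (theta ^+ N * X w)); last first.
  by rewrite ler_wpM2l// exprn_ge0// divr_ge0 ?ltW// addr_gt0.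
apply: feynman_kac_le => // [|v|v].
- by rewrite divr_ge0// ltW// addr_gt0.
- by rewrite /visit_weight mulr_ge0 ?invr_ge0 ?exprn_ge0// ltW.
rewrite /visit_weight /theta.
set E := beta ^+ _.
suff h : E * P X v <= (1 + a * eta) * X v.
  have -> : beta^-1 * E * P X v = E * P X v / beta by field; rewrite gt_eqF.
  have -> : (1 + a * eta) / beta * X v = (1 + a * eta) * X v / beta.
    by field; rewrite gt_eqF.
  by rewrite ler_pM2r ?invr_gt0.
rewrite /E {E}.
have := PX v; rewrite /ball_ind subr0; case: (modulus v <= K) => /=.
  rewrite mulr1 muln1 => PXv.
  apply: (@le_trans _ _ (beta ^+ d * ((1 - d%:R * x) * X v))).
    rewrite ler_pM2l ?exprn_gt0//; apply: le_trans PXv _.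
    have := X2 v; rewrite -subr_ge0 => X2'.
    have := X1 v => X1'.
    have : 0 <= a * (2 - X v) by rewrite mulr_ge0// ltW.
    have : a * eta <= a * eta * X v by rewrite ler_peMr// ltW.
    have : d%:R * x = a / 2 - a * eta by rewrite /x /eta; field; lra.
    move=> ->; lra.
  rewrite mulrA ler_wpM2r ?(le_trans _ (X1 v))//.
  apply: le_trans (bernoulli_reverse _ (ltW x0)) _; lra.
rewrite mulr0 subr0 muln0 expr0 mul1r => PXv.
apply: le_trans PXv _; rewrite mulrDl mul1r lerD2l.
by rewrite ler_peMr// ltW.
Qed.

End frequency.

(** * Recurrence *)

Section recurrence.
Context {R : realType} (mu : R[i]) (mu_gt1 : 1 < modulus mu).
Implicit Types (w : R[i]) (r x y : R).

Local Notation P := (transfer mu).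
Local Notation l := (modulus mu).

Let l0 : 0 < l. Proof. exact: lt_trans mu_gt1. Qed.

Let b : R := ((l - 1) ^+ 2)^-1.

Let b0 : 0 < b. Proof. by rewrite invr_gt0 exprn_gt0// subr_gt0. Qed.

Let V r : R := ln (Num.max 1 (r - b)).

Let V_ge0 r : 0 <= V r.
Proof. by rewrite ln_ge0// le_max lexx. Qed.

Let V_mono r r' : r <= r' -> V r <= V r'.
Proof.
by move=> rr'; rewrite ler_ln ?posrE ?lt_max ?ltr01// le_max2 ?lerD2r.
Qed.

(* The shift b is chosen such that [(r / l - b) (l r + 1 - b) <= (r - b)^2]. *)
Let V_superharmonic r : l * (b + 1) <= r -> V (r / l) + V (l * r + 1) <= 2 * V r.
Proof.
move=> rC.
have rb : b + 1 <= r / l by rewrite ler_pdivlMr// mulrC.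
have r0 : 0 < r by apply: lt_le_trans rC; rewrite mulr_gt0// addr_gt0.
have rl : r / l <= r by rewrite ler_pdivrMr// ler_peMr// ltW.
have rl' : r <= l * r by rewrite ler_peMl// ltW.
rewrite /V !max_r; [|lra..].
rewrite -lnM ?posrE; [|lra..].
have -> : 2 * ln (r - b) = ln ((r - b) ^+ 2).
  by rewrite lnXn ?mulr_natl//; lra.
rewrite ler_ln ?posrE; last 2 first.
- by rewrite mulr_gt0//; lra.
- by rewrite exprn_gt0//; lra.
rewrite -subr_ge0.
(* As [b (l - 1) ^ 2 = 1], the terms linear in [r] cancel and only [b] remains. *)
have -> : (r - b) ^+ 2 - (r / l - b) * (l * r + 1 - b) = b * (1 - b) + b ^+ 2.
  have lN : l - 1 != 0 by rewrite subr_eq0 gt_eqF.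
  by rewrite /b; field; rewrite lN gt_eqF.
have := b0; nra.
Qed.

Context (K : R) (K0 : 0 < K).

(** [H] is [V] minus a multiple of [|w|^-a], frozen below radius [K / l], plus a constant that keeps
    [V <= H]. The step [w / mu] multiplies [|w|^-a] by [l ^ a >= 4], and this gain outweighs the
    defect of [V] near the origin. *)
Let supersolution : exists H : R[i] -> R, exists2 A : R, 0 < A & exists a : nat,
  [/\ forall w, V (modulus w) <= H w &
   forall w, K < modulus w -> P H w <= H w - A * (modulus w ^+ a)^-1].
Proof.
have [a] := @expr_dominates _ l 1 4 mu_gt1 ltr01; rewrite mulr1 => la.
(* When [K < |w|], the truncation at [k0] affects neither [w] nor [w / mu]. *)
pose k0 := K / l; have k00 : 0 < k0 by rewrite divr_gt0.
pose C := l * (b + 1); have C0 : 0 < C by rewrite mulr_gt0// addr_gt0.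
pose M := V (l * C + 1).
have M0 : 0 < M.
  have : b + 1 <= C by rewrite ler_peMl ?ltW// addr_gt0.
  have : C <= l * C by rewrite ler_peMl// ltW.
  by move=> h1 h2; rewrite /M /V max_r ?ln_gt0; lra.
(* Where [r < C] and superharmonicity of [V] may fail, [A / r ^ a >= 2 M] covers both values of [V]
   after the step. *)
pose A := 2 * M * C ^+ a.
have A0 : 0 < A by rewrite !mulr_gt0// exprn_gt0.
pose psi r := (Num.max r k0 ^+ a)^-1.
have psi0 r : 0 <= psi r.
  by rewrite invr_ge0 exprn_ge0// le_max (ltW k00) orbT.
have psik r : psi r <= (k0 ^+ a)^-1.
  rewrite lef_pV2 ?posrE ?exprn_gt0 ?lt_max ?k00 ?orbT//.
  by rewrite lerXn2r ?nnegrE ?le_max ?lexx ?(ltW k00) ?orbT.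
exists (fun w => V (modulus w) + A * ((k0 ^+ a)^-1 - psi (modulus w))).
exists (A / 2); first by rewrite divr_gt0.
exists a; split=> [w|w Kw].
  by rewrite lerDl mulr_ge0// ?subr_ge0 ?psik ?(ltW A0).
rewrite /transfer.
set r := modulus w; set r1 := modulus (branch mu true w).
have r0 : 0 < r by exact: lt_trans Kw.
have -> : modulus (branch mu false w) = r / l.
  by rewrite /branch modulusM modulusV mulrC.
have r1r : r1 <= l * r + 1.
  by rewrite /r1 /branch (le_trans (modulusD _ _))// modulusM modulus1.
set p := (r ^+ a)^-1.
have p0 : 0 < p by rewrite invr_gt0 exprn_gt0.
have -> : psi r = p.
  rewrite /psi max_l// (le_trans _ (ltW Kw))//.
  by rewrite ler_pdivrMr// ler_peMr// ltW.
have psil : 4 * p <= psi (r / l).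
  rewrite /psi max_l; last by rewrite ler_pM2r ?invr_gt0// ltW.
  by rewrite expr_div_n invf_div mulrC mulrC ler_pM2r.
have psil' : A * (4 * p) <= A * psi (r / l) by rewrite ler_pM2l.
have psir1 : 0 <= A * psi r1 by rewrite mulr_ge0// ltW.
have Ap : 0 < A * p by rewrite mulr_gt0.
suff : V (r / l) + V r1 <= 2 * V r + A * p by lra.
have [Cr|rC] := leP C r.
  have := V_superharmonic Cr; have := V_mono r1r; lra.
have Vr1 : V r1 <= M.
  apply: V_mono; apply: le_trans r1r _.
  by rewrite lerD2r ler_pM2l// ltW.
have Vrl : V (r / l) <= M.
  apply: V_mono; apply: (@le_trans _ _ C).
    rewrite ler_pdivrMr//; apply: le_trans (ltW rC) _.
    by rewrite ler_peMr// ltW.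
  by have : C <= l * C by [rewrite ler_peMl// ltW|]; lra.
have : 2 * M <= A * p.
  rewrite /A -mulrA ler_peMr//; first by rewrite mulr_ge0// ltW.
  by rewrite /p ler_pdivlMr ?exprn_gt0// mul1r lerXn2r ?nnegrE// ltW.
have := V_ge0 r; lra.
Qed.

(** With this indicator, [feynman_kac] is the probability that the first [n] points avoid the disc.
    It is at most [H w / L + (1 - d) ^ n]: beyond [R0] the first term is at least 1, and before that
    its mean drop by [d] pays for the decay of the second. *)
Lemma hitting (e : R) w : 0 < e ->
  exists n, feynman_kac mu (fun v => (K < modulus v)%R%:R) n w <= e.
Proof.
move=> e0; have [H [A A0 [a [VH PH]]]] := supersolution.
have H0 v : 0 <= H v by exact: le_trans (VH v).
(* Makes [H w / L] at most [e / 2]; [R0] is then the radius where [V] reaches [L]. *)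
pose L := 2 * (H w + 1) / e.
have L0 : 0 < L by rewrite divr_gt0// mulr_gt0// ltr_wpDl.
pose R0 := expR L + b.
have R00 : 0 < R0 by rewrite addr_gt0// expR_gt0.
(* A lower bound for the mean drop of [H / L] while [K < |w| < R0], capped to keep [1 - d]
   positive. *)
pose d := Num.min 2^-1 (A * (R0 ^+ a)^-1 / L).
have d0 : 0 < d.
  by rewrite lt_min invr_gt0 ltr0n/= divr_gt0// mulr_gt0// invr_gt0 exprn_gt0.
have d1 : d <= 2^-1 by rewrite ge_min lexx.
have q0 : 0 < 1 - d by lra.
pose kappa v : R := (K < modulus v)%R%:R.
have kappa0 v : 0 <= kappa v by exact: ler0n.
have fk1 n v : feynman_kac mu kappa n v <= 1.
  rewrite -[leRHS](mulr1 1) -{1}(expr1n _ n).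
  apply: (@feynman_kac_le _ _ _ (fun=> 1)) => // u.
  rewrite /transfer /kappa; case: (_ < _); rewrite /=; lra.
have key n v : feynman_kac mu kappa n v <= L^-1 * H v + (1 - d) ^+ n.
  elim: n v => [|n IH] v.
    by rewrite /= expr0 lerDr mulr_ge0 ?invr_ge0 ?(ltW L0).
  have [vR|vR] := leP R0 (modulus v).
    apply: le_trans (fk1 _ _) _; apply: ler_wpDr; first exact/exprn_ge0/ltW.
    rewrite mulrC ler_pdivlMr// mul1r; apply: le_trans (VH v).
    apply: le_trans (V_mono vR).
    rewrite /V /R0 addrK -[leLHS]expRK.
    by rewrite ler_ln ?posrE ?expR_gt0 ?lt_max ?ltr01 ?le_max ?lexx ?orbT.
  change (kappa v * P (feynman_kac mu kappa n) v <= L^-1 * H v + (1 - d) ^+ n.+1).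
  have [Kv|Kv] := ltP K (modulus v); last first.
    rewrite {1}/kappa ltNge Kv mul0r addr_ge0// ?exprn_ge0 ?mulr_ge0 ?invr_ge0//;
    exact: ltW.
  rewrite {1}/kappa Kv mul1r.
  have h1 : P (feynman_kac mu kappa n) v <= L^-1 * P H v + (1 - d) ^+ n.
    apply: le_trans (le_transfer mu IH v) _.
    by rewrite /transfer; lra.
  apply: le_trans h1 _.
  have h2 : L^-1 * P H v <= L^-1 * H v - d.
    have := PH v Kv; rewrite -(ler_pM2l (_ : 0 < L^-1)) ?invr_gt0// mulrBr.
    move=> /le_trans; apply; rewrite lerD2l lerN2.
    apply: (@le_trans _ _ (A * (R0 ^+ a)^-1 / L)).
      by rewrite ge_min lexx orbT.
    rewrite mulrC ler_pM2l ?invr_gt0// ler_pM2l//.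
    rewrite lef_pV2 ?posrE ?exprn_gt0// ?(lt_trans K0)//.
    by rewrite lerXn2r ?nnegrE ?modulus_ge0// ltW.
  have : d * (1 - d) ^+ n <= d.
    by rewrite ler_piMr ?(ltW d0)// exprn_ile1//; lra.
  rewrite exprS; lra.
have [n hn] := @expr_dominates _ (1 - d)^-1 (e / 2) 1
  ltac:(by rewrite invf_gt1//; lra) ltac:(by rewrite divr_gt0).
exists n; apply: le_trans (key n w : _ <= _) _.
have : (1 - d) ^+ n <= e / 2.
  move: hn; rewrite exprVn mulrC ler_pdivlMr ?exprn_gt0// mul1r //.
have : L^-1 * H w <= e / 2.
  rewrite mulrC ler_pdivrMr// /L.
  have -> : e / 2 * (2 * (H w + 1) / e) = H w + 1 by field; rewrite gt_eqF.
  by rewrite lerDl.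
lra.
Qed.

End recurrence.

(** * Density of orbits *)

(* The slope Im / Re at least doubles at each squaring, as long as Re > 0. *)
Lemma exists_Re_pow2_le0 (R : realType) (z : R[i]) : complex.Im z != 0 ->
  exists j, complex.Re (z ^+ (2 ^ j)) <= 0 /\ complex.Im (z ^+ (2 ^ j)) != 0.
Proof.
move=> z0; apply: contrapT => /forallNP H.
have sqrE j : z ^+ (2 ^ j.+1) = z ^+ (2 ^ j) * z ^+ (2 ^ j).
  by rewrite expnS mul2n -addnn exprD.
have ReE (u : R[i]) : complex.Re (u * u) = complex.Re u ^+ 2 - complex.Im u ^+ 2.
  by case: u => x y; rewrite /= !expr2.
have ImE (u : R[i]) : complex.Im (u * u) = 2 * (complex.Re u * complex.Im u).
  by case: u => x y /=; ring.
have pos j : complex.Im (z ^+ (2 ^ j)) != 0 /\ 0 < complex.Re (z ^+ (2 ^ j)).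
  elim: j => [|j [IH1 IH2]].
    rewrite expr1; split => //; rewrite ltNge; apply/negP => h.
    by apply: (H 0%N); rewrite expr1.
  have im : complex.Im (z ^+ (2 ^ j.+1)) != 0.
    by rewrite sqrE ImE !mulf_neq0// gt_eqF.
  by split => //; rewrite ltNge; apply/negP => h; exact: (H j.+1).
pose t := `|complex.Im z| / complex.Re z.
have [_] := pos 0%N; rewrite expr1 => x0.
have t0 : 0 < t by rewrite divr_gt0// normr_gt0.
have grow j :
    t * 2 ^+ j * complex.Re (z ^+ (2 ^ j)) <= `|complex.Im (z ^+ (2 ^ j))|.
  elim: j => [|j IH].
    by rewrite expr0 mulr1 expr1 /t -mulrA mulVf ?mulr1// gt_eqF.
  have [y0 {}x0] := pos j.
  rewrite sqrE ImE ReE normrM (ger0_norm (_ : 0 <= 2))// normrM (gtr0_norm x0).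
  set x := complex.Re _ in x0 IH *; set y := `|_| in IH *.
  apply: (@le_trans _ _ (t * 2 ^+ j.+1 * x ^+ 2)).
    apply: ler_wpM2l; first by rewrite mulr_ge0 ?exprn_ge0// ltW.
    by rewrite gerBl sqr_ge0.
  by rewrite exprS; have := ler_wpM2r (ltW x0) IH; nra.
(* Once the slope is at least 1, the next square has nonpositive real part, contradicting [pos]. *)
have [j hj] := @expr_dominates R 2 t 1 ltac:(by rewrite ltr1n) t0.
have [_ xj] := pos j; have [_] := pos j.+1.
rewrite sqrE ReE -[complex.Im _ ^+ 2]real_normK ?num_real// subr_gt0.
rewrite ltr_pXn2r ?nnegrE ?normr_ge0 ?ltW// => /(le_lt_trans (grow j)).
by rewrite gtr_pMl// ltNge mulrC hj.
Qed.

Section density.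
Context {R : realType}.
Implicit Types (z w xi : R[i]).

(** Rounding the coefficient [c] down costs at most 1 and [xi] does not enlarge the inner error, so
    each Horner level adds at most 1. *)
Lemma horner_approx xi z w (c : R) : modulus xi <= 1 -> 0 <= c ->
  exists n : nat,
    modulus (c%:C + xi * z - (n%:R + xi * w)) <= 1 + modulus (z - w).
Proof.
move=> xi1 c0; exists (Num.truncn c).
have -> : c%:C + xi * z - ((Num.truncn c)%:R + xi * w)
    = (c - (Num.truncn c)%:R)%:C + xi * (z - w).
  by rewrite rmorphB/= rmorph_nat; ring.
apply: le_trans (modulusD _ _) _; apply: lerD.
  have /andP[h1 h2] := truncn_itv c0.
  by rewrite modulusC ?subr_ge0// lerBlDr addrC -natr1 in h2 *; exact: ltW.
by rewrite modulusM ler_piMl// modulus_ge0.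
Qed.

(* [xi] is a root of [X^2 + p X + q] with [p >= 0] and [q > 0], so that [-1] and
   [-xi] are combinations of powers of [xi] with nonnegative coefficients. *)
Lemma powers_relatively_dense xi z :
  complex.Re xi <= 0 -> complex.Im xi != 0 -> modulus xi <= 1 ->
  exists n0 n1 n2 n3 : nat,
    modulus (z - (n0%:R + xi * (n1%:R + xi * (n2%:R + xi * n3%:R)))) <= 4.
Proof.
move=> re im xi1.
pose x := complex.Re xi; pose y := complex.Im xi.
pose q := x ^+ 2 + y ^+ 2.
have q0 : 0 < q by rewrite ltr_wpDl ?sqr_ge0// exprn_even_gt0.
(* [z = a + b xi] in the real basis [1, xi]. *)
pose b := complex.Im z / y; pose a := complex.Re z - b * x.
have split_sign (u : R) : exists u1 u2, [/\ 0 <= u1, 0 <= u2 & u = u1 - u2].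
  have [u0|/ltW u0] := leP 0 u; first by exists u, 0; rewrite subr0.
  by exists 0, (- u); rewrite oppr_ge0 opprK add0r.
have [a1 [a2 [a10 a20 aE]]] := split_sign a.
have [b1 [b2 [b10 b20 bE]]] := split_sign b.
pose p := - 2 * x; have p0 : 0 <= p by rewrite /p; have := re; rewrite -/x; lra.
(* The negative parts [- a2] and [- b2 xi] are rewritten through [-1 = (p xi + xi ^ 2) / q]. *)
pose c0 := a1; pose c1 := b1 + a2 * p / q.
pose c2 := a2 / q + b2 * p / q; pose c3 := b2 / q.
have q'0 := ltW q0.
have c10 : 0 <= c1 by apply: addr_ge0 => //; apply/divr_ge0/q'0/mulr_ge0.
have c20 : 0 <= c2.
  by apply: addr_ge0; [exact: divr_ge0|apply/divr_ge0/q'0/mulr_ge0].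
have c30 : 0 <= c3 by exact: divr_ge0.
have zE : z = c0%:C + xi * (c1%:C + xi * (c2%:C + xi * (c3%:C + xi * 0))).
  have xiE : xi = x +i* y by rewrite /x /y; case: (xi).
  have zE' : z = (a + b * x) +i* (b * y).
    rewrite /a /b addrNK mulrAC -mulrA divff// mulr1.
    by case: (z).
  rewrite zE' xiE aE bE /c0 /c1 /c2 /c3 /p mulr0 addr0.
  apply/eqP; rewrite eq_complex /= {im}; apply/andP; split; apply/eqP.
    by rewrite /q; field; rewrite -/q gt_eqF.
  by rewrite /q; field; rewrite -/q gt_eqF.
have [n3 h3] := horner_approx 0 0 xi1 c30.
have [n2 h2] := horner_approx (c3%:C + xi * 0) (n3%:R + xi * 0) xi1 c20.
have [n1 h1] := horner_approx (c2%:C + xi * (c3%:C + xi * 0))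
  (n2%:R + xi * (n3%:R + xi * 0)) xi1 c10.
have [n0 h0] := horner_approx (c1%:C + xi * (c2%:C + xi * (c3%:C + xi * 0)))
  (n1%:R + xi * (n2%:R + xi * (n3%:R + xi * 0))) xi1 (a10 : 0 <= c0).
exists n0, n1, n2, n3; rewrite zE.
move: h0 h1 h2 h3; rewrite !mulr0 !addr0 subrr modulus0; lra.
Qed.

Context (mu : R[i]) (mu_gt1 : 1 < modulus mu).

Local Notation SG := (semigroup (branch mu)).

Let mu0 : mu != 0.
Proof. by rewrite -modulus_eq0 gt_eqF// (lt_trans ltr01). Qed.

Lemma semigroup_translate h n : SG h -> SG (fun w => h w + n%:R).
Proof.
move=> Sh; elim: n => [|n IH].
  by under eq_fun do rewrite addr0.
have -> : (fun w => h w + n.+1%:R) =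
    branch mu true \o (branch mu false \o (fun w => h w + n%:R)).
  by apply/funext => w; rewrite /= /branch -addn1 natrD; field.
apply: semigroup_comp; first exact: (semigroup_gen (branch mu) true).
by apply: semigroup_comp => //; exact: (semigroup_gen (branch mu) false).
Qed.

Lemma semigroup_contract h n : SG h -> SG (fun w => mu^-1 ^+ n * h w).
Proof.
move=> Sh; elim: n => [|n IH].
  by under eq_fun do rewrite expr0 mul1r.
have -> : (fun w => mu^-1 ^+ n.+1 * h w) =
    branch mu false \o (fun w => mu^-1 ^+ n * h w).
  by apply/funext => w; rewrite /= /branch exprS mulrA.
by apply: semigroup_comp => //; exact: (semigroup_gen (branch mu) false).
Qed.

(** It suffices to approximate [mu ^ m * v] with bounded error and then to contract by [mu ^ m]. The
    approximation uses powers of [xi], a power of [mu^-1] in the closed left half-plane. *)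
Lemma branch_orbit_dense (mu_im : complex.Im mu != 0) w v (e : R) : 0 < e ->
  exists2 h, SG h & modulus (h w - v) < e.
Proof.
move=> e0; pose zeta := mu^-1.
have zeta1 : modulus zeta < 1 by rewrite modulusV invf_lt1// (lt_trans ltr01).
have zeta_im : complex.Im zeta != 0.
  rewrite /zeta; case: (mu) mu_im => x y /= y0.
  rewrite oppr_eq0 mulf_neq0// invr_eq0 gt_eqF// ltr_wpDl ?sqr_ge0//.
  by rewrite exprn_even_gt0.
have [j [xi_re xi_im]] := exists_Re_pow2_le0 zeta_im.
have zetaX n : modulus (zeta ^+ n) <= 1.
  by rewrite modulusX exprn_ile1 ?modulus_ge0// ltW.
(* The error before contracting is at most 4 + 1, from [powers_relatively_dense] and from the
   starting point. *)
have [m hm] := @expr_dominates R (modulus mu) (e / 6) 1 mu_gt1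
  ltac:(by rewrite divr_gt0).
have [k hk] := @expr_dominates R (modulus mu) 1 (modulus w) mu_gt1 ltr01.
set xi := zeta ^+ (2 ^ j) in xi_re xi_im.
have [n0 [n1 [n2 [n3 hn]]]] :=
  powers_relatively_dense (mu ^+ m * v) xi_re xi_im (zetaX _).
(* Horner's scheme as a word of contractions and unit translations. It begins with one
   [branch mu false] because the semigroup has no empty word. *)
exists (fun w => zeta ^+ m * (xi * (xi * (xi * (zeta ^+ k * branch mu false w
  + n3%:R) + n2%:R) + n1%:R) + n0%:R)).
  apply: semigroup_contract; apply: semigroup_translate.
  do 3!(apply: semigroup_contract; apply: semigroup_translate).
  by apply: semigroup_contract; exact: (semigroup_gen (branch mu) false).
set S := n0%:R + _ in hn.
set u := zeta ^+ k * branch mu false w.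
have -> : zeta ^+ m * (xi * (xi * (xi * (u + n3%:R) + n2%:R) + n1%:R) + n0%:R) - v
    = zeta ^+ m * (xi ^+ 3 * u + - (mu ^+ m * v - S)).
  have vE : v = zeta ^+ m * (mu ^+ m * v).
    by rewrite mulrA -exprMn mulVf// expr1n mul1r.
  by rewrite {1}vE /S; ring.
have u1 : modulus u <= 1.
  rewrite /u /branch -/zeta mulrA -exprSr modulusM exprSr modulusM mulrAC.
  rewrite mulr_ile1 ?mulr_ge0 ?modulus_ge0 ?(ltW zeta1)//.
  rewrite modulusX modulusV exprVn mulrC ler_pdivrMr ?mul1r -1?[leRHS]mulr1//.
  by rewrite exprn_gt0// (lt_trans ltr01).
have mm : 0 < modulus mu ^+ m by rewrite exprn_gt0// (lt_trans ltr01).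
rewrite modulusM modulusX modulusV exprVn mulrC ltr_pdivrMr//.
apply: (@le_lt_trans _ _ 5).
  apply: le_trans (modulusD _ _) _; rewrite modulusN.
  have : modulus (xi ^+ 3 * u) <= 1.
    by rewrite modulusM mulr_ile1 ?modulus_ge0// /xi -exprM.
  by lra.
have : 0 < e / 6 by rewrite divr_gt0.
by have := hm; nra.
Qed.

End density.

(** * The sphere in the coordinate 1/z *)

Definition chart (R : realType) (w : R[i]) : sphere R :=
  if w == 0 then None else Some w^-1.

(* The value at Some 0, which is not in the range of chart, is junk. *)
Definition chart_inv (R : realType) (x : sphere R) : R[i] :=
  if x is Some z then z^-1 else 0.

Section chart.
Context {R : realType}.
Implicit Types (z w c : R[i]) (x : sphere R).

Lemma chartK w : chart_inv (chart w) = w.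
Proof. by rewrite /chart; case: eqP => [->|_] //=; rewrite invrK. Qed.

Lemma chart_neq0 w : chart w <> Some 0.
Proof.
by rewrite /chart; case: eqP => // /eqP w0 [] /eqP; rewrite invr_eq0 (negPf w0).
Qed.

Lemma chart_invK x : x <> Some 0 -> chart (chart_inv x) = x.
Proof.
case: x => [z z0|_]; last by rewrite /chart /= eqxx.
rewrite /chart /= invr_eq0; case: eqP => [z00|_]; last by rewrite invrK.
by case: z0; rewrite z00.
Qed.

Lemma sphere_ball0_chart (e : R) w : 0 < e ->
  sphere_ball0 e (chart w) <-> e^-1 < modulus w.
Proof.
move=> e0; rewrite /sphere_ball0 /chart; case: eqP => [->|/eqP w0].
  by rewrite modulus0; split => [[]//|]; rewrite ltNge invr_ge0 ltW.
have mw : 0 < modulus w by rewrite lt_neqAle modulus_ge0 eq_sym modulus_eq0 w0.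
rewrite -[e^-1 < _]invf_plt ?posrE// -modulusV.
split=> [[z /= + [<-]]|h]; first by rewrite normE ltcE/= eqxx.
by exists w^-1 => //=; rewrite normE ltcE/= eqxx.
Qed.

Context (mu : R[i]) (mu0 : mu != 0).

Lemma ifs_chart b w : ifs mu b (chart w) = chart (branch mu b w).
Proof.
rewrite /ifs /chart /branch; case: b; case: (eqVneq w 0) => [->|w0] /=.
- by rewrite mulr0 add0r oner_eq0 invr1 mulr1.
- rewrite mul1r addr0.
  have -> : w^-1 + mu = (mu * w + 1) / w by field.
  rewrite mulf_eq0 invr_eq0 (negPf w0) orbF; case: eqP => // /eqP h.
  by congr Some; field; rewrite h w0.
- by rewrite mulr0 eqxx.
- rewrite mul0r add0r oner_eq0 mulf_eq0 invr_eq0 (negPf mu0) (negPf w0) /=.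
  by congr Some; field; rewrite mu0 w0.
Qed.

Lemma ifs_fix0 b : ifs mu b (Some 0) = Some 0.
Proof.
rewrite /ifs; case: b => /=; rewrite !mulr0 !add0r ?oner_eq0 ?(negPf mu0);
by congr Some; rewrite ?mul0r.
Qed.

Lemma semigroup_chart h : semigroup (branch mu) h ->
  exists2 g, semigroup (ifs mu) g & forall w, g (chart w) = chart (h w).
Proof.
elim=> [b|h1 h2 _ [g1 S1 E1] _ [g2 S2 E2]].
  by exists (ifs mu b); [exact: (semigroup_gen (ifs mu) b)|exact: ifs_chart].
by exists (g1 \o g2); [exact: semigroup_comp|move=> w; rewrite /= E2 E1].
Qed.

Lemma random_iter_chart (s : Sigma) n w :
  random_iter (ifs mu) s n (chart w) = chart (random_iter (branch mu) s n w).
Proof. by elim: n => //= n ->; rewrite ifs_chart. Qed.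

Lemma nbhs_modulus z (A : set R[i]) :
  nbhs z A <-> exists2 e : R, 0 < e & forall y, modulus (z - y) < e -> A y.
Proof.
split=> [/(nbhs_ballP z)[e /=]|[e e0 H]].
  rewrite ltcE /= => /andP[/eqP ei e0] H; exists (complex.Re e) => // y h.
  by apply: H; rewrite /ball /= normE ltcE/= h ei eqxx.
apply/(nbhs_ballP z); exists e%:C; first by rewrite /= ltcE/= eqxx.
by move=> y; rewrite /ball /= normE ltcE /= eqxx => /H.
Qed.

Lemma continuous_modulus : continuous (@modulus R).
Proof.
move=> z A /= /nbhs_ballP[e /= e0 H]; apply/(nbhs_modulus z); exists e => // y zy.
apply: H; rewrite /ball /= ltr_norml; apply/andP; split.
  have := modulusD (y - z) z; rewrite subrK -(modulusN (y - z)) opprB; lra.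
by have := modulusD (z - y) y; rewrite subrK; lra.
Qed.

(** Every nonempty open set contains a finite nonzero point, and inversion is continuous there. *)
Lemma open_sphere_chart (U : set (sphere R)) : open U -> U !=set0 ->
  exists v (e : R), 0 < e /\ forall w, modulus (w - v) < e -> U (chart w).
Proof.
move=> oU [x Ux].
have finite_pt : exists z, U (Some z).
  case: x Ux => [z Uz|Uoo]; first by exists z.
  have : nbhs (None : sphere R) U by exact: open_nbhs_nbhs.
  (* A neighbourhood of infinity contains the finite points outside a compact set, hence all those
     of large modulus. *)
  case=> C [cptC _] CU.
  have cptM : compact [set modulus z | z in C].
    apply: continuous_compact cptC; apply: continuous_subspaceT.
    exact: continuous_modulus.
  have [M [_ HM]] := @compact_bounded R R^o _ cptM.
  have M1 : M < `|M| + 1 by rewrite (le_lt_trans (ler_norm _))// ltrDl.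
  have M2 : 0 <= `|M| + 2 by rewrite addr_ge0.
  exists (`|M| + 2)%:C; apply: CU; left; exists (`|M| + 2)%:C => //= CM.
  have /(HM _ M1) : [set modulus z | z in C] (`|M| + 2).
    by exists (`|M| + 2)%:C => //; rewrite modulusC.
  by rewrite /= ger0_norm//; lra.
have nz_pt : exists2 z, z != 0 & U (Some z).
  case: finite_pt => z Uz; have [z0|z0] := eqVneq z 0; last by exists z.
  have : nbhs (Some z : sphere R) U by exact: open_nbhs_nbhs.
  move=> /(nbhs_modulus z)[e e0 H]; exists (e / 2)%:C.
    by rewrite -modulus_eq0 modulusC ?gt_eqF ?divr_gt0// divr_ge0 ?ltW.
  apply: H; rewrite z0 sub0r modulusN modulusC ?divr_ge0 ?ltW//.
  by rewrite ltr_pdivrMr// ltr_pMr// ltr1n.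
case: nz_pt => z z0 Uz.
have : nbhs (Some z : sphere R) U by exact: open_nbhs_nbhs.
move=> /(nbhs_modulus z)[e e0 H].
pose v := z^-1; have v0 : v != 0 by rewrite invr_eq0.
have mv : 0 < modulus v by rewrite lt_neqAle modulus_ge0 eq_sym modulus_eq0 v0.
(* The first bound keeps [|w|] above [|v| / 2]; the second then gives
   [|z - w^-1| = |w - v| / |w v| < e]. *)
exists v, (Num.min (modulus v / 2) (e * modulus v ^+ 2 / 2)); split.
  by rewrite lt_min !divr_gt0// mulr_gt0// exprn_gt0.
move=> w; rewrite lt_min => /andP[h1 h2].
have mw : modulus v / 2 < modulus w.
  have : modulus v <= modulus (v - w) + modulus w.
    by rewrite -[v in leLHS](subrK w) modulusD.
  by rewrite -(modulusN (v - w)) opprB; lra.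
have mw0 : 0 < modulus w by rewrite (lt_trans _ mw)// divr_gt0.
have w0 : w != 0 by rewrite -modulus_eq0 gt_eqF.
rewrite /chart (negPf w0); apply: H.
have -> : z - w^-1 = (w - v) / (w * v) by rewrite /v; field; rewrite z0 w0.
rewrite modulusM modulusV modulusM ltr_pdivrMr ?mulr_gt0//.
apply: lt_le_trans h2 _; rewrite expr2.
have : 0 < e * modulus v by rewrite mulr_gt0.
by nra.
Qed.

End chart.

(** * Stationary measures *)

(** The first condition discards the junk value of [chart_inv] at [Some 0]; infinity, where [w = 0],
    belongs to the disc when [modulus c <= rho]. *)
Definition chart_disc (R : realType) (c : R[i]) (rho : R) : set (sphere R) :=
  [set x | x <> Some 0 /\ modulus (chart_inv x - c) <= rho].

Section stationary.
Context {R : realType}.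
Implicit Types (c w z : R[i]) (rho : R).

Lemma measurable_open_sphere (U : set (sphere R)) : open U -> measurable U.
Proof. exact: sub_sigma_algebra. Qed.

Lemma measurable_infty : measurable [set None : sphere R].
Proof.
have -> : [set None : sphere R] = ~` (Some @` setT).
  apply/seteqP; split=> [x -> [z _]//|[z h|//]].
  by exfalso; apply: h; exists z.
apply: measurableC; apply: measurable_open_sphere.
exact/one_point_compactification_open_some/openT.
Qed.

Lemma measurable_chart_disc c rho : 0 <= rho -> measurable (chart_disc c rho).
Proof.
(* The outside of the disc in the coordinate z: [rho < |z^-1 - c|] is cleared of its denominator so
   that 0 belongs to it. *)
move=> rho0; pose O := [set z : R[i] | rho * modulus z < modulus (1 - c * z)].
have oO : open O.
  rewrite openE => z /= Oz; apply/(nbhs_modulus z).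
  pose k := modulus c + rho + 1.
  have k0 : 0 < k by rewrite ltr_wpDl// addr_ge0// modulus_ge0.
  exists ((modulus (1 - c * z) - rho * modulus z) / k).
    by rewrite divr_gt0// subr_gt0.
  move=> y; rewrite ltr_pdivlMr// /O /k /=.
  have h1 :
      modulus (1 - c * z) <= modulus (1 - c * y) + modulus c * modulus (z - y).
    rewrite -modulusM -[modulus (c * _)]modulusN.
    have -> : 1 - c * z = (1 - c * y) + - (c * (z - y)) by ring.
    exact: modulusD.
  have h2 : modulus y <= modulus z + modulus (z - y).
    rewrite -[modulus (z - y)]modulusN -{1}(subrK z y) addrC opprB.
    exact: modulusD.
  have := modulus_ge0 (z - y); have := ler_wpM2l rho0 h2; nra.
have -> : chart_disc c rho = (~` (Some @` O) `&` ~` [set None]) `|`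
    (if modulus c <= rho then [set None] else set0).
  apply/seteqP; split=> [[z|]|[z|]].
  - move=> [z0 /= h]; left; split => // -[y Oy [yz]].
    move: Oy; rewrite /O /= yz ltNge; apply/negP; rewrite negbK.
    have {}z0 : z != 0 by apply/eqP => h0; apply: z0; rewrite h0.
    have -> : 1 - c * z = z * (z^-1 - c) by field.
    by rewrite modulusM mulrC ler_wpM2r ?modulus_ge0.
  - by move=> [_ /=]; rewrite sub0r modulusN => ->; right.
  - move=> [[h _]|]; last by case: ifP.
    have {}h : modulus (1 - c * z) <= rho * modulus z.
      by rewrite leNgt; apply/negP => Oz; apply: h; exists z.
    have z0 : z != 0.
      apply/eqP => z0; move: h.
      by rewrite z0 mulr0 subr0 modulus0 mulr0 modulus1 ler10.
    split; first by move=> [] /eqP; rewrite (negPf z0).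
    have mz : 0 < modulus z.
      by rewrite lt_neqAle modulus_ge0 eq_sym modulus_eq0 z0.
    rewrite /= -(ler_pM2r mz) -modulusM mulrBl mulVf//.
  - move=> [[_ h]|]; first by exfalso; exact: h.
    by case: ifP => // h _; split => //=; rewrite sub0r modulusN.
apply: measurableU.
  apply: measurableI; apply: measurableC; last exact: measurable_infty.
  apply: measurable_open_sphere.
  exact: one_point_compactification_open_some.
by case: ifP => _ //; exact: measurable_infty.
Qed.

Lemma chart_disc_cover : ~` [set Some 0] = \bigcup_n chart_disc (0 : R[i]) n%:R.
Proof.
apply/seteqP; split=> [x x0|x [n _ [x0 _]]]; last exact: x0.
exists (Num.bound (modulus (chart_inv x))) => //; split => //.
by rewrite subr0 ltW// archi_boundP// modulus_ge0.
Qed.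

Lemma measurable_sphere0 : measurable [set Some 0 : sphere R].
Proof.
rewrite -[X in measurable X]setCK chart_disc_cover; apply: measurableC.
by apply: bigcupT_measurable => n; exact: measurable_chart_disc.
Qed.

Context (mu : R[i]) (mu_gt1 : 1 < modulus mu) (mu1 : mu != 1).

Local Notation P := (transfer mu).
Local Notation l := (modulus mu).

Let l0 : 0 < l. Proof. exact: lt_trans mu_gt1. Qed.
Let mu0 : mu != 0. Proof. by rewrite -modulus_eq0 gt_eqF. Qed.

Lemma preimage_chart_disc b c rho : ifs mu b @^-1` chart_disc c rho =
  if b then chart_disc ((c - 1) / mu) (rho / l)
  else chart_disc (mu * c) (l * rho).
Proof.
apply/funext => x; apply/propext; rewrite /preimage /=.
have [->|x0] := pselect (x = Some 0).
  by rewrite ifs_fix0//; case: b; split; case.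
rewrite -(chart_invK x0) ifs_chart//; case: b; rewrite /chart_disc /= !chartK.
  by rewrite modulus_branch1//; split=> -[_ ?]; split => //; exact: chart_neq0.
by rewrite modulus_branch0//; split=> -[_ ?]; split => //; exact: chart_neq0.
Qed.

Context (m : probability (sphere R) R).
Context (m_stat : is_stationary 2^-1 2^-1 (ifs mu) m).

(** The probability of being in the disc after [n] steps, as a function on the sphere; it vanishes
    at the fixed point [Some 0], from which no disc is reached. *)
Let visit n c rho (x : sphere R) : R :=
  (x != Some 0)%:R * iter n P (ball_ind c rho) (chart_inv x).

Let visit_ge0 n c rho x : 0 <= visit n c rho x.
Proof.
by rewrite mulr_ge0// iter_transfer_ge0// => w; exact: ball_ind_ge0.
Qed.

Let visitS n c rho x : visit n.+1 c rho x = 2^-1 *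
  (visit n (mu * c) (l * rho) x + visit n ((c - 1) / mu) (rho / l) x).
Proof.
by rewrite /visit iterSr transfer_ball_ind// iter_transferZ iter_transferD; ring.
Qed.

(** Stationarity, used [n] times. It is applied only to discs, whose preimages are discs, so the
    induction runs over all centres and radii; additivity of the integral needs measurability
    alongside. *)
Let integral_visit n c rho : 0 <= rho -> measurable_fun setT (visit n c rho) /\
  m (chart_disc c rho) = (\int[m]_x (visit n c rho x)%:E)%E.
Proof.
elim: n c rho => [|n IH] c rho rho0.
  have -> : visit 0 c rho = \1_(chart_disc c rho).
    apply/funext => x; rewrite /visit indicE /= /ball_ind -natrM mulnb.
    congr ((nat_of_bool _)%:R); apply/idP/idP.
      by move=> /andP[/eqP x0 h]; rewrite inE.
    by rewrite inE => -[/eqP -> ->].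
  have mD := measurable_chart_disc c rho0.
  by split; [exact: measurable_indic|rewrite integral_indic// setIT].
have [M1 E1] := IH (mu * c) (l * rho) (mulr_ge0 (ltW l0) rho0).
have [M2 E2] := IH ((c - 1) / mu) (rho / l) (divr_ge0 rho0 (ltW l0)).
have -> : visit n.+1 c rho = fun x => 2^-1 *
    (visit n (mu * c) (l * rho) x + visit n ((c - 1) / mu) (rho / l) x).
  by apply/funext => x; exact: visitS.
split; first by apply: measurable_funM => //; exact: measurable_funD.
rewrite m_stat; last exact: measurable_chart_disc.
rewrite /pushforward !preimage_chart_disc E1 E2.
under [in RHS]eq_integral do rewrite EFinM EFinD.
rewrite ge0_integralZl_EFin//.
- rewrite ge0_integralD//.
  + by rewrite [RHS]ge0_muleDr//; apply: integral_ge0 => x _; rewrite lee_fin.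
  + by move=> x _; rewrite lee_fin.
  + exact/measurable_EFinP.
  + by move=> x _; rewrite lee_fin.
  + exact/measurable_EFinP.
- by move=> x _; rewrite -EFinD lee_fin addr_ge0.
- under eq_fun do rewrite -EFinD.
  by apply/measurable_EFinP; exact: measurable_funD.
Qed.

Lemma stationary_chart_disc c rho : 0 <= rho -> m (chart_disc c rho) = 0%E.
Proof.
move=> rho0; apply/eqP; rewrite eq_le measure_ge0 andbT.
apply/lee_addgt0Pr => e e0; rewrite add0e.
have [n hn] := concentration mu_gt1 mu1 e0 rho0.
have [M ->] := integral_visit n c rho0.
rewrite -[leRHS]mule1 -(@probability_setT _ _ _ m) -integral_cst//.
apply: ge0_le_integral => //=.
- by move=> x _; rewrite lee_fin.
- exact/measurable_EFinP.
move=> x _; rewrite lee_fin /visit.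
by case: (x != Some 0); rewrite ?mul1r ?mul0r; [exact: hn|exact: ltW].
Qed.

Lemma stationary_unique A : measurable A ->
  m A = @dirac _ (sphere R) (Some 0) R A.
Proof.
move=> mA.
have m0 : m (~` [set Some 0]) = 0%E.
  rewrite chart_disc_cover.
  have mD n : measurable (chart_disc (0 : R[i]) n%:R).
    exact: measurable_chart_disc.
  apply/negligibleP; first exact: bigcupT_measurable.
  apply: negligible_bigcup => n; apply/negligibleP => //.
  exact: stationary_chart_disc.
have null (B : set (sphere R)) : measurable B -> ~ B (Some 0) -> m B = 0%E.
  move=> mB B0; apply/eqP; rewrite eq_le measure_ge0 andbT -m0.
  apply: le_measure; rewrite ?inE//.
    by apply: measurableC; exact: measurable_sphere0.
  by move=> x Bx x0; apply: B0; rewrite -x0.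
rewrite diracE; have [A0|A0] := pselect (A (Some 0)); last first.
  by rewrite null// memNset.
rewrite mem_set//= -[A]setCK probability_setC; last exact: measurableC.
by rewrite null ?sube0//; exact: measurableC.
Qed.

End stationary.

(** * Almost sure statements *)

Lemma eq_random_iter (X : Type) (f : bool -> X -> X) (s t : Sigma) n x :
  (forall i, (i < n)%N -> s i = t i) -> random_iter f s n x = random_iter f t n x.
Proof.
elim: n => //= n IH h; rewrite h// IH// => i ni.
by apply: h; exact: leqW.
Qed.

Lemma measurable_cylinder s : measurable (cylinder s).
Proof.
have -> : cylinder s =
    \bigcap_(i in `I_(size s)) [set w : Sigma | w i = nth false s i] by [].
apply: bigcap_measurableType => // i _; apply: sub_sigma_algebra.
have /continuousP cont : continuous (fun w : Sigma => w i).
  exact: (@proj_continuous nat (fun=> bool) i).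
by apply: (cont [set nth false s i]); exact: discrete_open.
Qed.

Lemma cylinder_rcons s :
  cylinder s = cylinder (rcons s false) `|` cylinder (rcons s true).
Proof.
apply/seteqP; split=> [w ws|w].
  suff wb : cylinder (rcons s (w (size s))) w by case: (w _) wb; [right|left].
  move=> i; rewrite size_rcons ltnS nth_rcons.
  by case: ltngtP => // [/ws//|-> _].
by case=> h i si; have := h i; rewrite size_rcons leqW// nth_rcons si; apply.
Qed.

(** In the induction over words, [c] carries the weight already collected along [s]; the product
    covers only the next [n] points. *)
Definition weight_event (R : realType) (mu w0 : R[i]) (kappa : R[i] -> R)
    (s : seq bool) (n : nat) (c : R) : set Sigma :=
  cylinder s `&` [set w | 1 <= c * \prod_(size s <= k < size s + n)
                                    kappa (random_iter (branch mu) w k w0)].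

Section markov.
Context {R : realType} (nu : probability Sigma R).
Context (nu_half : is_bernoulli 2^-1 2^-1 nu).
Context (mu : R[i]) (w0 : R[i]).

Local Notation walk := (fun s n => random_iter (branch mu) s n w0).

Lemma bernoulli_cylinder s : nu (cylinder s) = (2^-1 ^+ size s)%:E.
Proof.
rewrite nu_half; congr EFin; under eq_bigr do rewrite if_same.
by rewrite big_const_seq count_predT iter_mulr_1.
Qed.

Let position (s : seq bool) : R[i] := walk (nth false s) (size s).

Let walk_cylinder s w : cylinder s w -> walk w (size s) = position s.
Proof. exact: eq_random_iter. Qed.

Let position_rcons s b : position (rcons s b) = branch mu b (position s).
Proof.
rewrite /position size_rcons /= nth_rcons ltnn eqxx.
by congr (branch mu b _); apply: eq_random_iter => i si; rewrite nth_rcons si.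
Qed.

(** Markov's inequality for the product of the weights, proved over the tree of cylinders without
    integration on [Sigma]: each step splits a cylinder by its next letter and moves one factor into
    [c]. *)
Lemma feynman_kac_probability (kappa : R[i] -> R) n s (c : R) :
  (forall w, 0 <= kappa w) -> 0 <= c ->
  measurable (weight_event mu w0 kappa s n c) /\
  (nu (weight_event mu w0 kappa s n c) <= (2^-1 ^+ size s *
    (c * feynman_kac mu kappa n (walk (nth false s) (size s))))%:E)%E.
Proof.
move=> k0; elim: n s c => [|n IH] s c c0 /=.
  have [c1|c1] := leP 1 c.
    have -> : weight_event mu w0 kappa s 0 c = cylinder s.
      by apply/setIidl => w _ /=; rewrite addn0 big_geq// mulr1.
    split; first exact: measurable_cylinder.
    by rewrite bernoulli_cylinder lee_fin mulr1 ler_peMr// exprn_ge0.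
  have -> : weight_event mu w0 kappa s 0 c = set0.
    rewrite -subset0 => w [_] /=; rewrite addn0 big_geq// mulr1.
    by rewrite leNgt c1.
  split=> //; rewrite measure0 lee_fin !mulr_ge0// exprn_ge0//.
rewrite -/(position s).
pose c' := c * kappa (position s).
have c'0 : 0 <= c' by rewrite mulr_ge0.
have [mF lF] := IH (rcons s false) c' c'0.
have [mT lT] := IH (rcons s true) c' c'0.
move: mF lF mT lT; rewrite -!/(position (rcons s _)) !position_rcons.
rewrite !size_rcons.
set AF := weight_event _ _ _ (rcons s false) _ _.
set AT := weight_event _ _ _ (rcons s true) _ _.
move=> mF lF mT lT.
have -> : weight_event mu w0 kappa s n.+1 c = AF `|` AT.
  have cutE b w : cylinder (rcons s b) w ->
      c * \prod_(size s <= k < size s + n.+1) kappa (walk w k)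
      = c' * \prod_((size s).+1 <= k < (size s).+1 + n) kappa (walk w k).
    move=> wb; rewrite big_ltn ?addnS ?ltnS ?leq_addr// mulrA walk_cylinder//.
    by rewrite cylinder_rcons; case: b wb; [right|left].
  rewrite /weight_event cylinder_rcons setIUl /AF /AT /weight_event !size_rcons.
  congr (_ `|` _); apply/seteqP; split=> w [wb /=]; rewrite (cutE _ _ wb) => h;
    by split => //=; rewrite (cutE _ _ wb).
split; first exact: measurableU.
apply: le_trans (measureU2 _ mF mT) _.
apply: le_trans (leeD lF lT) _.
rewrite -EFinD lee_fin exprS /c' /transfer.
by rewrite le_eqVlt; apply/orP; left; apply/eqP; field.
Qed.

(** If the disc is visited only finitely often, some finite word is followed by points outside the
    disc only. For each of the countably many words this has probability 0 by [hitting]. *)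
Lemma visits_io (K : R) : 1 < modulus mu -> 0 < K ->
  nu.-negligible [set w | ~ infinite_set [set n | modulus (walk w n) <= K]].
Proof.
move=> mu_gt1 K0.
pose kappa (v : R[i]) : R := (K < modulus v)%R%:R.
have kappa0 v : 0 <= kappa v by exact: ler0n.
pose A s n := weight_event mu w0 kappa s n 1.
have mA s n : measurable (A s n).
  by have [] := @feynman_kac_probability kappa n s 1 kappa0 ler01.
have nullA s : nu.-negligible (\bigcap_n A s n).
  apply/negligibleP; first exact: bigcapT_measurable.
  apply/eqP; rewrite eq_le measure_ge0 andbT.
  apply/lee_addgt0Pr => e e0; rewrite add0e.
  have [n hn] := @hitting R mu mu_gt1 K K0 e (position s) e0.
  have [_ +] := @feynman_kac_probability kappa n s 1 kappa0 ler01.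
  rewrite -/(A s n) => lA.
  apply: le_trans (le_measure _ _ _ (@bigcap_inf _ _ n setT (A s) I)) _;
    rewrite ?inE//; first exact: bigcapT_measurable.
  apply: le_trans lA _; rewrite lee_fin mul1r -/(position s).
  apply: le_trans hn; rewrite ler_piMl//; first exact: feynman_kac_ge0.
  by rewrite exprn_ile1// invf_le1// ler1n.
pose B m := if unpickle m is Some s then \bigcap_n A s n else set0.
apply: (@negligibleS _ _ _ _ (\bigcup_m B m)); last first.
  apply: negligible_bigcup => m; rewrite /B; case: unpickle => [s|] //.
  exact: negligible_set0.
move=> w /= /contrapT/finite_seqP[r rE].
have [N far] : exists N, forall n, (N <= n)%N -> K < modulus (walk w n).
  exists (\max_(n <- r) n).+1 => n Nn; rewrite ltNge; apply/negP => wn.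
  have : [set n | modulus (walk w n) <= K] n by [].
  rewrite rE /= => nr; have := @leq_bigmax_seq _ r xpredT id n nr isT.
  by rewrite leqNgt Nn.
exists (pickle (mkseq w N)) => //; rewrite /B pickleK => n _; split.
  by move=> i; rewrite size_mkseq => iN; rewrite nth_mkseq.
rewrite /= size_mkseq mul1r big_nat big1// => k /andP[Nk _].
by rewrite /kappa far.
Qed.

Lemma prod_visit_weight (K beta : R) d w N : beta != 0 ->
  \prod_(0 <= k < N) visit_weight K beta d (walk w k)
    = beta ^- N * beta ^+ (d * \sum_(k < N) (modulus (walk w k) <= K)%R).
Proof.
move=> b0; rewrite big_mkord /visit_weight big_split /= prodr_const card_ord.
by rewrite exprVn big_distrr /= expr_sum.
Qed.

(** When [N] is at most [d] times the number of visits before time [N], the product of the weights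
    is at least 1, which has probability at most [2 theta ^ N]. These bounds are summable, so
    Borel-Cantelli applies. *)
Lemma visits_frequency (K : R) d : 1 < modulus mu -> mu != 1 -> 0 <= K ->
  nu.-negligible [set w | ~ exists N0, forall N, (N0 <= N)%N ->
    (d * \sum_(k < N) (modulus (walk w k) <= K)%R < N)%N].
Proof.
move=> mu_gt1 mu1 K0.
have [beta [theta [b1 t0 t1 fkb]]] := visits_exponential_bound mu_gt1 mu1 d K0.
have b0 : 0 < beta by exact: lt_trans b1.
have kappa0 v : 0 <= visit_weight K beta d v.
  by rewrite /visit_weight mulr_ge0 ?invr_ge0 ?exprn_ge0// ltW.
pose A N := weight_event mu w0 (visit_weight K beta d) [::] N 1.
have AP N := @feynman_kac_probability _ N [::] 1 kappa0 ler01.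
have mA N : measurable (A N) by have [] := AP N.
have A_le N : (nu (A N) <= (theta ^+ N * 2)%:E)%E.
  have [_ h] := AP N; apply: le_trans h _.
  by rewrite expr0 !mul1r lee_fin fkb.
apply: (@negligibleS _ _ _ _ (lim_sup_set A)).
  move=> w /= H n _; apply: contrapT => nA; apply: H; exists n => N nN.
  rewrite ltnNge; apply/negP => le_N; apply: nA; exists N => //; split => //=.
  rewrite mul1r add0n prod_visit_weight ?gt_eqF// mulrC.
  rewrite ler_pdivlMr ?exprn_gt0// mul1r.
  by rewrite ler_weXn2l// ltW.
apply/negligibleP.
  by apply: bigcapT_measurable => n; exact: bigcup_measurable.
apply: lim_sup_set_cvg0 => //.
apply: (@le_lt_trans _ _ (2 / (1 - theta))%:E); last exact: ltry.
apply: lime_le; first exact: is_cvg_nneseries.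
apply: nearW => n.
apply: (@le_trans _ _ (\sum_(0 <= k < n) (theta ^+ k * 2)%:E)%E).
  by apply: lee_sum => k _; exact: A_le.
rewrite sumEFin lee_fin ler_pdivlMr ?subr_gt0//.
have -> : (\sum_(0 <= k < n) theta ^+ k * 2) * (1 - theta) = 2 - 2 * theta ^+ n.
  elim: n => [|n IH]; first by rewrite big_geq// mul0r expr0 mulr1 subrr.
  by rewrite big_nat_recr//= mulrDl IH exprS; ring.
by rewrite gerBl mulr_ge0// exprn_ge0// ltW.
Qed.

End markov.

Lemma ae_of_negligible d (T : measurableType d) (R : realType)
    (m : {measure set T -> \bar R}) (N : set T) (P : T -> Prop) :
  m.-negligible N -> (forall x, ~ N x -> P x) -> \forall x \ae m, P x.
Proof.
move=> N0 NP; apply: negligibleS N0 => x Px.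
by apply: contrapT => /NP.
Qed.

Lemma sphere_lebesgue0 (R : realType) : @sphere_lebesgue R [set Some 0] = 0%E.
Proof.
rewrite /sphere_lebesgue /pushforward.
have -> : @sphere_point R @^-1` [set Some 0] = [set 0] `*` [set 0].
  apply/seteqP; split=> [[x y] /= [-> ->]//|[x y] /= [-> ->]].
  by rewrite /sphere_point.
by rewrite product_measure1E//= lebesgue_measure_set1 mul0e.
Qed.

Lemma dirac_stationary (R : realType) (mu : R[i]) : mu != 0 ->
  is_stationary 2^-1 2^-1 (ifs mu) (@dirac _ (sphere R) (Some 0) R).
Proof.
move=> mu0 A mA.
have fixE b : pushforward (@dirac _ (sphere R) (Some 0) R) (ifs mu b) A
    = @dirac _ (sphere R) (Some 0) R A.
  rewrite /pushforward !diracE; congr ((nat_of_bool _)%:R%:E).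
  by apply/idP/idP; rewrite !inE /preimage /= ifs_fix0.
by rewrite !fixE !diracE -!EFinM -EFinD; congr EFin; field.
Qed.

Theorem theorem4p1 (R : realType) (mu : R[i])
    (mu_gt1 : 1 < `|mu|) (mu_nonreal : mu \isn't Num.real) :
  [/\ forall z0 : sphere R, z0 <> Some 0 -> dense (semigroup_orbit (ifs mu) z0),
      is_stationary 2^-1 2^-1 (ifs mu) (@dirac _ (sphere R) (Some 0) R) /\
      (forall m : probability (sphere R) R, is_stationary 2^-1 2^-1 (ifs mu) m ->
         forall A, measurable A -> m A = @dirac _ (sphere R) (Some 0) R A)
    & forall nu : probability Sigma R, is_bernoulli 2^-1 2^-1 nu ->
      forall eps : R, 0 < eps ->
      \forall z \ae @sphere_lebesgue R, \forall w \ae nu,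
        infinite_set
          [set n | ~ sphere_ball0 eps (random_iter (ifs mu) w n z)] /\
        N%:R^-1 * #|[pred n : 'I_N |
            random_iter (ifs mu) w n z \in sphere_ball0 eps]|%:R
          @[N --> \oo] --> (1 : R)].
Proof.
have gt1 : 1 < modulus mu by move: mu_gt1; rewrite normE ltcE/= => /andP[].
have mu0 : mu != 0 by rewrite -modulus_eq0 gt_eqF// (lt_trans ltr01).
have mu1 : mu != 1 by apply: contraNneq mu_nonreal => ->; exact: real1.
have mu_im : complex.Im mu != 0.
  apply: contraNneq mu_nonreal; case: (mu) => x y /= ->.
  by rewrite realE !lecE /= eqxx /= -realE num_real.
split.
- move=> z0 z00 O O0 oO; have [v [e [e0 H]]] := open_sphere_chart oO O0.
  have [h Sh hv] := branch_orbit_dense gt1 mu_im (chart_inv z0) v e0.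
  have [g Sg gE] := semigroup_chart mu0 Sh.
  exists (chart (h (chart_inv z0))); split; first exact: H.
  by exists g => //; rewrite -[in LHS](chart_invK z00) gE.
- by split; [exact: dirac_stationary|exact: stationary_unique].
move=> nu nuB eps eps0.
(* The common fixed point 0 is the only starting point to discard. *)
apply: (@ae_of_negligible _ (sphere R) R (@sphere_lebesgue R) [set Some 0]).
  apply/negligibleP; first exact: measurable_sphere0.
  exact: sphere_lebesgue0.
move=> z z0.
rewrite -(chart_invK z0); set w0 := chart_inv z.
pose K := eps^-1; have K0 : 0 < K by rewrite invr_gt0.
pose visits s N := (\sum_(k < N)
  (modulus (random_iter (branch mu) s k w0) <= K)%R)%N.
pose rare d := [set s : Sigma | ~ exists N0, forall N, (N0 <= N)%N ->
  (d * visits s N < N)%N].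
have ballE s n : sphere_ball0 eps (random_iter (ifs mu) s n (chart w0)) <->
    K < modulus (random_iter (branch mu) s n w0).
  by rewrite random_iter_chart//; exact: sphere_ball0_chart.
apply: (@ae_of_negligible _ Sigma R nu
  ([set s | ~ infinite_set
      [set n | modulus (random_iter (branch mu) s n w0) <= K]]
   `|` \bigcup_d rare d)).
  apply: negligibleU; first exact: visits_io.
  by apply: negligible_bigcup => d; apply: visits_frequency => //; exact: ltW.
move=> s /not_orP[io good]; split.
  move/contrapT: io; apply: sub_infinite_set => n /= h.
  by move/ballE; rewrite ltNge h.
apply/cvgrPdist_lt => e e0.
(* With [1 / d < e], fewer than [N / d] visits to the disc leave a frequency within [e] of 1. *)
pose d := (Num.bound e^-1).
have de : e^-1 < d%:R by apply: archi_boundP; rewrite invr_ge0 ltW.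
have d0 : 0 < d%:R :> R by rewrite (lt_trans _ de)// invr_gt0.
have [N0 HN] : exists N0, forall N, (N0 <= N)%N -> (d * visits s N < N)%N.
  by apply: contrapT => h; apply: good; exists d.
exists N0 => // N /= N0N; have vN := HN N N0N.
have N1 : 0 < N%:R :> R by rewrite ltr0n (leq_ltn_trans _ vN).
have -> : #|[pred n : 'I_N | random_iter (ifs mu) s n (chart w0) \in
    sphere_ball0 eps]|%:R = N%:R - (visits s N)%:R :> R.
  apply/eqP; rewrite eq_sym subr_eq -natrD; apply/eqP; congr (_%:R).
  rewrite -sum1_card big_mkcond /= -big_split /= -[LHS]card_ord -sum1_card.
  apply: eq_bigr => i _; rewrite inE.
  have -> : (random_iter (ifs mu) s i (chart w0) \in sphere_ball0 eps) =
      (K < modulus (random_iter (branch mu) s i w0)).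
    by apply/idP/idP; rewrite inE => /ballE.
  by rewrite ltNge; case: (_ <= _).
rewrite mulrBr mulVf ?gt_eqF// opprB addrC subrK ger0_norm; last first.
  by rewrite mulr_ge0// invr_ge0 ltW.
rewrite mulrC ltr_pdivrMr//.
have h : d%:R * (visits s N)%:R < N%:R :> R by rewrite -natrM ltr_nat.
have ed : 1 < e * d%:R by rewrite -ltr_pdivrMl// mulr1.
have : 0 <= (visits s N)%:R :> R by [].
by nra.
Qed.
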